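(* Let $\lambda\vdash n$ be a Young diagram. 1) The Specht module $SP_\lambda$ is the submodule of the space of forms $L_\lambda$ consisting of all forms in $L_\lambda$ that depend only on the differences of the variables. 2) The Specht module $SP_\lambda$, as a representation of $\mathfrak S_n$, is the irreducible representation $\pi_\lambda$ corresponding to the diagram $\lambda$. 3) The Specht polynomials $SP_t$, where $t$ ranges over all standard tableaux of shape $\lambda$, form a basis of the Specht module $SP_\lambda$.
   Context: Everything is over $\mathbb C$; $\mathfrak S_n$ acts on $\mathbb C[x_1,\dots,x_n]$ by permutations of the variables. Cells of $\lambda$ are denoted $(i,j)$, $i$ = row, $j$ = column; $\lambda_1$ is the length of the first row and $n'=n-\lambda_1$. The space $L_\lambda$: for $n'$ variables $y_{i,j}$ indexed by the cells $(i,j)$ of $\lambda$ with $i>1$, let $X_\lambda(\{y_{i,j}\})=\prod_{(i,j),\,i>1}y_{i,j}^{\,i-1}$. $L_\lambda\subset\mathbb C[x_1,\dots,x_n]$ is the linear span of all monomials obtained from $X_\lambda$ by substituting for the $y_{i,j}$ any $n'$ distinct variables chosen from $x_1,\dots,x_n$ (in any assignment). Specht polynomials: for a tableau $t$ of shape $\lambda$ (a bijective filling of the cells by $1,\dots,n$), place in the cell $(i,j)$ the variable $x_{t(i,j)}$. The Specht polynomial is $SP_t=\prod_j\prod_{s<k}(x_{t(s,j)}-x_{t(k,j)})$, where $j$ runs over the columns and $s<k$ over the pairs of row indices of cells in the $j$th column (a product of Vandermonde determinants over the columns). The Specht module $SP_\lambda$ is the linear span of all polynomials obtained from $SP_t$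 by permutations of the variables. A form depends only on the differences of the variables if it is invariant under simultaneously adding a constant to all variables $x_1,\dots,x_n$. The irreducible representation $\pi_\lambda$ is the one having a basis indexed by standard Young tableaux $T$ of shape $\lambda$ on which each Jucys–Murphy element $X_i=(1\,i)+\dots+(i-1\,i)$ acts diagonally with eigenvalue the content (column index minus row index) of the cell of $T$ containing $i$; $\lambda\mapsto\pi_\lambda$ is a bijection between diagrams with $n$ cells and classes of irreducible complex representations of $\mathfrak S_n$. *)

(* Defs.v *)
From HB Require Import structures.
From mathcomp Require Import all_boot all_order all_algebra all_fingroup.
From mathcomp Require Import mxrepresentation.
From mathcomp Require Import reals.
From mathcomp Require Import complex.
From mathcomp Require Import mpoly.

Set Implicit Arguments.
Unset Strict Implicit.
Unset Printing Implicit Defensive.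

Import GRing.Theory.
Local Open Scope ring_scope.

Definition is_partition (lam : seq nat) (n : nat) : bool :=
  [&& sorted geq lam, 0%N \notin lam & sumn lam == n].

(* Rows and columns are numbered from 0, so that [row c] is the exponent i - 1
   attached to a cell (i, j); contents are unaffected by the shift. *)
Definition cell (lam : seq nat) : finType :=
  {i : 'I_(size lam) & 'I_(nth 0%N lam i)}.

Definition row (lam : seq nat) (c : cell lam) : nat := tag c.
Definition col (lam : seq nat) (c : cell lam) : nat := tagged c.
Definition content (lam : seq nat) (c : cell lam) : int :=
  (col c)%:Z - (row c)%:Z.

Record tableau (lam : seq nat) (n : nat) := Tableau {
  tabfun :> {ffun cell lam -> 'I_n};
  _ : injectiveb tabfun && [forall k, k \in codom tabfun] }.
HB.instance Definition _ (lam : seq nat) (n : nat) :=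
  [isSub for @tabfun lam n].
HB.instance Definition _ (lam : seq nat) (n : nat) :=
  [Finite of tableau lam n by <:].

Definition is_standard (lam : seq nat) (n : nat) (t : tableau lam n) : bool :=
  [forall c1, forall c2,
     ((row c1 == row c2) && (col c1 < col c2)%N
      || (col c1 == col c2) && (row c1 < row c2)%N) ==> (t c1 < t c2)%N].

Record std_tableau (lam : seq nat) (n : nat) := StdTableau {
  std_tab :> tableau lam n;
  _ : is_standard std_tab }.
HB.instance Definition _ (lam : seq nat) (n : nat) :=
  [isSub for @std_tab lam n].
HB.instance Definition _ (lam : seq nat) (n : nat) :=
  [Finite of std_tableau lam n by <:].

Definition in_span (K : fieldType) (V : lmodType K) (I : finType)
    (P : pred I) (F : I -> V) (v : V) : Prop :=
  exists a : I -> K, v = \sum_(i | P i) a i *: F i.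

Definition is_basis (K : fieldType) (V : lmodType K) (I : finType)
    (U : V -> Prop) (F : I -> V) : Prop :=
  (forall a : I -> K, \sum_i a i *: F i = 0 -> forall i, a i = 0)
  /\ (forall v, U v <-> in_span predT F v).

(* [msym s] substitutes 'X_(s i) for 'X_i.  Since (s * s') i = s' (s i) in
   {perm _}, it is a right action, as are the row-vector actions of
   [mx_representation]. *)
Definition is_submodule (K : fieldType) (n : nat)
    (U : {mpoly K[n]} -> Prop) : Prop :=
  [/\ U 0,
      forall (a : K) (p q : {mpoly K[n]}), U p -> U q -> U (a *: p + q)
    & forall (s : 'S_n) (p : {mpoly K[n]}), U p -> U (msym s p)].

Definition lower_cell (lam : seq nat) : finType := {c : cell lam | (0 < row c)%N}.

Definition Xmon (K : fieldType) (lam : seq nat) (n : nat)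
    (y : {ffun lower_cell lam -> 'I_n}) : {mpoly K[n]} :=
  \prod_c 'X_(y c) ^+ row (val c).

Definition in_L (K : fieldType) (lam : seq nat) (n : nat) :
    {mpoly K[n]} -> Prop :=
  in_span (fun y : {ffun lower_cell lam -> 'I_n} => injectiveb y)
          (@Xmon K lam n).

Definition specht_poly (K : fieldType) (lam : seq nat) (n : nat)
    (t : tableau lam n) : {mpoly K[n]} :=
  \prod_(c1 : cell lam)
    \prod_(c2 : cell lam | (col c1 == col c2) && (row c1 < row c2)%N)
      ('X_(t c1) - 'X_(t c2)).

Definition in_specht (K : fieldType) (lam : seq nat) (n : nat)
    (t : tableau lam n) : {mpoly K[n]} -> Prop :=
  in_span predT (fun s : 'S_n => msym s (specht_poly K t)).

Definition translation_invariant (K : fieldType) (n : nat)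
    (p : {mpoly K[n]}) : Prop :=
  forall a : K, p \mPo [tuple 'X_i + a%:MP | i < n] = p.

Definition JM (K : fieldType) (n d : nat)
    (rho : mx_representation K [set: 'S_n]%G d) (k : 'I_n) : 'M[K]_d :=
  \sum_(i < n | (i < k)%N) rho (tperm i k).

(* rho belongs to the isomorphism class pi_lam. *)
Definition is_pi (K : fieldType) (lam : seq nat) (n d : nat)
    (rho : mx_representation K [set: 'S_n]%G d) : Prop :=
  mx_irreducible rho
  /\ exists v : std_tableau lam n -> 'rV[K]_d,
       is_basis (fun _ => True) v
       /\ forall (T : std_tableau lam n) (c : cell lam),
            v T *m JM rho (T c) = (content c)%:~R *: v T.

Definition affords (K : fieldType) (n d : nat) (U : {mpoly K[n]} -> Prop)
    (rho : mx_representation K [set: 'S_n]%G d) : Prop :=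
  exists phi : {linear 'rV[K]_d -> {mpoly K[n]}},
    [/\ injective phi,
        forall p, U p <-> exists v, p = phi v
      & forall (s : 'S_n) (v : 'rV[K]_d), phi (v *m rho s) = msym s (phi v)].

(* Main.v *)
From HB Require Import structures.
Require Import Defs.
From mathcomp Require Import all_boot all_order all_algebra all_fingroup.
From mathcomp Require Import mxrepresentation.
From mathcomp Require Import reals.
From mathcomp Require Import complex.
From mathcomp Require Import mpoly.
From mathcomp Require Import zify ring.

(** Read an exponent vector w as a word with letters w 0, ..., w (n-1), that
is, as a basis tensor of the n-th tensor power of a space with basis e_0, e_1,
and so on.  The forms in L_lam become the tensors of weight lam: the letter a
occurs lam_a times in each of their monomials.  The sum of the partial
derivatives sends a monomial to the sum, over the letters a, of a + 1 times the
action of the matrix unit E_(a,a+1); the terms of different a have different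
weights and cannot cancel.  Hence a form of L_lam depends only on the
differences of the variables exactly when it is a highest weight vector of
weight lam for the general linear Lie algebra.  The whole proof is about the
space H of these highest weight vectors.

A basis of H is found by leading terms.  Compare words by their last
differing letter.  If w is the leading word of a nonzero p in H, then the part
of p with the same letters as w from position m on is, on the first m
positions, again a highest weight vector; such a vector has a dominant weight,
by the representation theory of sl_2 ([raise_inj_lt]).  So every prefix of w
contains the letter a at least as often as b when a < b
([highest_lead_lattice]), and such words of weight lam are the words of the
standard tableaux, where position k carries the row of the entry k.  On the
other hand a Specht polynomial lies in H: it is a product of Vandermonde
determinants, whose monomials have weight lam ([weighted_specht]), and it
depends on differences only.  For a standard tableau its leading word is the
word of that tableau ([lead_word_specht]).  So the standard Specht polynomials
form a basis of H, and H is the Specht module ([in_spechtP]).  This gives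
the first and the third assertion.

For the second one, the sum of all transpositions of the first m positions is
essentially the Casimir element of the general linear Lie algebra, and acts on
highest weight vectors by a scalar ([sum_transpositions]).  Applied to the
prefixes of the leading word of p, this shows that the k-th Jucys-Murphy
element multiplies p by the content of the cell of k, up to smaller words
([jm_triangular]).  The Jucys-Murphy elements are self-adjoint for the
permutation-invariant hermitian form on L_lam in which the monomials are
orthogonal, so orthogonalising the standard Specht polynomials turns this
triangular action into a diagonal one ([young_vector_exists]): this is Young's
orthogonal basis up to scalars.  Finally let T0 be the standard tableau with
the smallest word.  Its basis vector is a multiple of the Specht polynomial of
T0, hence generates H.  A nonzero submodule is not orthogonal to a
generator, and since the contents separate standard tableaux
([content_vector_inj]) polynomials in the Jucys-Murphy elements project the
submodule onto that basis vector.  So the submodule is everything. *)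

Set Implicit Arguments.
Unset Strict Implicit.
Unset Printing Implicit Defensive.

Import Order.TTheory GRing.Theory Num.Theory.
Local Open Scope ring_scope.

Local Notation "m # s" := [multinom m (s i) | i < _]
  (at level 40, left associativity, format "m # s").
Local Notation crow := Defs.row.
Local Notation ccol := Defs.col.

(** * Words and matrix units *)
Section Words.
Variable n : nat.
Implicit Types (w u : 'X_{1..n}) (S : pred 'I_n).

Definition upd w (k : 'I_n) (b : nat) : 'X_{1..n} :=
  [multinom if i == k then b else w i | i < n].

Definition cnt S w (a : nat) : nat := #|[pred k | S k && (w k == a)]|.

Lemma updE w k b i : upd w k b i = if i == k then b else w i.
Proof. by rewrite mnmE. Qed.

Lemma upd_id w k a : w k = a -> upd w k a = w.
Proof. by move=> wk; apply/mnmP=> i; rewrite updE; case: eqP => // ->. Qed.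

Lemma upd_upd w k a b : upd (upd w k a) k b = upd w k b.
Proof. by apply/mnmP=> i; rewrite !updE; case: eqP. Qed.

Lemma updC w k l a b : k != l -> upd (upd w k a) l b = upd (upd w l b) k a.
Proof.
move=> kl; apply/mnmP=> i; rewrite !updE.
by case: (i =P l) => [->|//]; rewrite eq_sym (negPf kl).
Qed.

Lemma cnt_upd_new S w k b :
  S k -> w k != b -> cnt S (upd w k b) b = (cnt S w b).+1.
Proof.
move=> Sk wkb; rewrite /cnt (cardD1 k) !inE Sk updE !eqxx add1n; congr _.+1.
apply: eq_card => i; rewrite !inE updE; case: (i =P k) => [->|//].
by rewrite (negPf wkb) andbF.
Qed.

Lemma cnt_upd_old S w k b :
  S k -> w k != b -> cnt S w (w k) = (cnt S (upd w k b) (w k)).+1.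
Proof.
move=> Sk wkb.
have <- := @cnt_upd_new S (upd w k b) k (w k) Sk.
  by rewrite upd_upd upd_id.
by rewrite updE eqxx eq_sym.
Qed.

Lemma cnt_upd_other S w k b c :
  c != w k -> c != b -> cnt S (upd w k b) c = cnt S w c.
Proof.
move=> cw cb; apply: eq_card => i; rewrite !inE updE.
by case: (i =P k) => [->|//]; rewrite ![_ == c]eq_sym (negPf cw) (negPf cb).
Qed.


Lemma cnt_mperm S w (s : 'S_n) a :
  (forall k, S (s k) = S k) -> cnt S (w#s) a = cnt S w a.
Proof.
move=> Ss; rewrite /cnt -!sum1_card [RHS](reindex_inj (@perm_inj _ s)).
by apply: eq_bigl => k; rewrite !inE Ss mnmE.
Qed.

End Words.

Section Raising.
Variables (n : nat) (F : numFieldType) (S : pred 'I_n).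
Implicit Types (w u : 'X_{1..n}) (g : 'X_{1..n} -> F).

(** The coefficient of w in E_ab g, where g is the tensor with coefficients
[g u] and E_ab, which maps e_b to e_a, acts as a derivation on the positions
in [S]. *)
Definition raise (a b : nat) g w : F :=
  \sum_(k | S k && (w k == a)) g (upd w k b).

Lemma eq_raise a b g1 g2 : g1 =1 g2 -> raise a b g1 =1 raise a b g2.
Proof. by move=> eg w; apply: eq_bigr => k _; rewrite eg. Qed.

Lemma raise_scale a b g c w : raise a b (fun u => c * g u) w = c * raise a b g w.
Proof. by rewrite /raise mulr_sumr. Qed.

Lemma raise_diag a g w : raise a a g w = (cnt S w a)%:R * g w.
Proof.
rewrite mulr_natl /raise (eq_bigr (fun=> g w)) => [|k /andP[_ /eqP wk]].
  by rewrite sumr_const.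
by rewrite upd_id.
Qed.

(** In E_ab E_bd the two unit matrices act either on the same position, which
gives E_ad, or on two different ones. *)
Lemma raise_comp a b d g w : a != b ->
  raise a b (raise b d g) w = raise a d g w
    + \sum_(k | S k && (w k == a)) \sum_(l | S l && (w l == b))
        g (upd (upd w k b) l d).
Proof.
move=> ab; rewrite /raise -big_split /=; apply: eq_bigr => k /andP[Sk /eqP wk].
rewrite (bigD1 k) /= ?updE ?Sk ?eqxx // upd_upd; congr (_ + _).
apply: eq_bigl => l; rewrite updE; case: (l =P k) => [->|] /=.
  by rewrite wk (negPf ab) eqxx !andbF.
by rewrite andbT.
Qed.

(** The part of E_ab E_bd living on two different positions is symmetric in the
two factors, so it cancels in commutators. *)
Lemma raise_swap a b d g w : a != b ->
  \sum_(k | S k && (w k == a)) \sum_(l | S l && (w l == b))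
     g (upd (upd w k b) l d)
  = \sum_(l | S l && (w l == b)) \sum_(k | S k && (w k == a))
     g (upd (upd w l d) k b).
Proof.
move=> ab; rewrite exchange_big /=; apply: eq_bigr => l /andP[_ /eqP wl].
apply: eq_bigr => k /andP[_ /eqP wk]; rewrite updC //.
by apply: contraNneq ab => kl; rewrite -wk kl wl.
Qed.

Lemma raise_commut a b d g w : a != b -> a != d ->
  raise a b (raise b d g) w = raise a d g w + raise b d (raise a b g) w.
Proof.
move=> ab ad; rewrite raise_comp // raise_swap //; congr (_ + _).
apply: eq_bigr => l /andP[_ /eqP wl]; apply: eq_bigl => k; rewrite updE.
case: (k =P l) => [->|//].
by rewrite wl ![_ == a]eq_sym (negPf ab) (negPf ad).
Qed.

(** The relation [E_ab, E_ba] = E_aa - E_bb, written without subtraction. *)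
Lemma raise_weight a b g w : a != b ->
  raise a b (raise b a g) w + (cnt S w b)%:R * g w =
  raise b a (raise a b g) w + (cnt S w a)%:R * g w.
Proof.
move=> ab; have ba : b != a by rewrite eq_sym.
rewrite [X in X + _]raise_comp // raise_swap // raise_diag.
rewrite [X in _ = X + _]raise_comp // raise_diag addrC addrA addrAC -!addrA.
by congr (_ + _); rewrite addrC.
Qed.

(** E_ab is an iterated commutator of the E_(c,c+1) with a <= c < b. *)
Lemma raise_killed_trans g : (forall a w, raise a a.+1 g w = 0) ->
  forall a b w, (a < b)%N -> raise a b g w = 0.
Proof.
move=> g0 a b + ab; rewrite -(subnK ab); elim: (b - a.+1)%N => [|k IH] w.
  by rewrite add0n.
have z h u : (forall v, h v = 0) -> forall c d, raise c d h u = 0.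
  by move=> h0 c d; apply: big1 => i _; apply: h0.
have := @raise_commut a (k + a.+1) (k.+1 + a.+1) g w.
rewrite (z _ _ (g0 _)) (z _ _ IH) addr0 => <- //; apply/eqP; lia.
Qed.

(** The sl_2 computation: on a vector of weight - d killed by the raising
operator E, one has E F^(k+1) = - (k+1)(d+k) F^k. *)
Lemma raise_lower_iter a b d g : a != b ->
  (forall w, raise a b g w = 0) ->
  (forall w, g w != 0 -> cnt S w b = (cnt S w a + d)%N) ->
  forall k,
   (forall w, iter k (raise b a) g w != 0 ->
      cnt S w b = (cnt S w a + d + k.*2)%N) /\
   (forall w, raise a b (iter k.+1 (raise b a) g) w =
      - (k.+1 * (d + k))%:R * iter k (raise b a) g w).
Proof.
move=> ab g0 gw; elim=> [|k [IHw IH]].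
  split=> [w /gw ->|w /=]; first by rewrite addn0.
  have := @raise_weight a b g w ab.
  rewrite (@eq_raise b a _ (fun=> 0)) // [X in _ = X + _]big1 // add0r.
  have [->|/gw ->] := eqVneq (g w) 0; first by rewrite !mulr0 addr0.
  by move/(canRL (addrK _)) ->; rewrite mul1n addn0 natrD; ring.
have IHw1 w : iter k.+1 (raise b a) g w != 0 ->
    cnt S w b = (cnt S w a + d + k.+1.*2)%N.
  rewrite /= /raise => nz; have [i /andP[Si /eqP wi] nzi] :
      exists2 i, S i && (w i == b) & iter k (raise b a) g (upd w i a) != 0.
    apply/exists_inP; rewrite -negb_forall_in; apply: contra nz => /forall_inP z.
    by rewrite big1 // => i /z /eqP.
  have wia : w i != a by rewrite wi eq_sym.
  have := IHw _ nzi; rewrite cnt_upd_new // -wi (cnt_upd_old Si wia) wi; lia.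
split=> [//|w].
have := @raise_weight a b (iter k.+1 (raise b a) g) w ab.
rewrite (@eq_raise b a _ _ IH) raise_scale.
rewrite -[X in _ = _ * X + _]/(iter k.+1 (raise b a) g w).
have [->|nz] := eqVneq (iter k.+1 (raise b a) g w) 0.
  by rewrite !mulr0 !addr0.
have cw : cnt S w b = (cnt S w a + d + k.+1.*2)%N by exact: IHw1.
by move/(canRL (addrK _)) ->; rewrite cw -muln2 !natrD !natrM !natrD; ring.
Qed.


(** A vector of negative weight killed by the raising operator vanishes: large
powers of F kill it for lack of letters b, and since the factors (k+1)(d+k) do
not vanish, the powers of F can be removed one by one. *)
Lemma raise_inj_lt a b d g : a != b -> (0 < d)%N ->
  (forall w, raise a b g w = 0) ->
  (forall w, g w != 0 -> cnt S w b = (cnt S w a + d)%N) ->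
  forall w, g w = 0.
Proof.
move=> ab d0 g0 gw.
have fact := raise_lower_iter ab g0 gw.
suff z k w : iter k (raise b a) g w = 0 by exact: (z 0%N).
have [N leN] : exists N, (n < N + k)%N by exists n.+1; lia.
(* Downward induction on the power k, starting above n. *)
elim: N k w leN => [|N IH] k w leN.
  apply/eqP; apply: contraTT leN => /(proj1 (fact k)) cw.
  have : (cnt S w b <= n)%N by rewrite -[X in (_ <= X)%N]card_ord max_card.
  lia.
have := proj2 (fact k) w; rewrite [LHS]big1; last first.
  by move=> i _; apply: IH; rewrite addnS.
move/esym/eqP; rewrite mulf_eq0 oppr_eq0 pnatr_eq0 muln_eq0 /= => /orP[|/eqP//].
by rewrite addn_eq0; lia.
Qed.

End Raising.

(** * Transpositions acting on highest weight vectors *)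
Section Casimir.
Variables (n : nat) (F : numFieldType) (S : pred 'I_n).
Implicit Types (w u : 'X_{1..n}) (g : 'X_{1..n} -> F).

(** If the entry k lies in the row [w k] of a standard tableau, then [occ w k]
is its column. *)
Definition occ w (k : 'I_n) : nat :=
  #|[pred i : 'I_n | (i < k)%N && (w i == w k)]|.

Lemma mperm_tperm w (i j : 'I_n) :
  w # tperm i j = upd (upd w j (w i)) i (w j).
Proof.
apply/mnmP => k; rewrite mnmE !updE permE /=.
by case: (k =P i) => // _; case: (k =P j).
Qed.

(** For each letter a below b = [w j], the equation E_ab g = 0 at the word
obtained from w by putting a at the position j says that the exchanges of this
b with the letters a of w sum to minus the coefficient of w. *)
Lemma swap_down_sum g w (j : 'I_n) : S j ->
  (forall a b u, (a < b)%N -> raise S a b g u = 0) ->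
  \sum_(i | S i && (w i < w j)%N) g (w # tperm i j) = - (w j)%:R * g w.
Proof.
move=> Sj g0.
transitivity (\sum_(a < w j) \sum_(i | S i && (w i == a)) g (w # tperm i j)).
  rewrite (exchange_big_dep S) => [|a i _ /andP[]//] /=.
  rewrite big_mkcondr; apply: eq_bigr => i Si.
  case: ltnP => wij; last first.
    by rewrite big_pred0 // => a; apply/negP => /andP[_ /eqP]; have := ltn_ord a; lia.
  by rewrite (big_pred1 (Ordinal wij)) // => a; rewrite Si eq_sym.
rewrite (eq_bigr (fun=> - g w)) => [|a _].
  by rewrite sumr_const card_ord mulNrn mulNr mulr_natl.
apply/eqP; rewrite -addr_eq0; apply/eqP.
rewrite -[RHS](g0 a (w j) (upd w j a)) // /raise [RHS](bigD1 j) /=; last first.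
  by rewrite updE Sj !eqxx.
rewrite upd_upd upd_id // addrC; congr (_ + _).
apply: congr_big => // [i|i /andP[_ /eqP wi]]; last by rewrite mperm_tperm wi.
rewrite updE; case: (i =P j) => [->|_]; last by rewrite andbT.
by rewrite eqxx andbF gtn_eqF ?andbF.
Qed.

(** A pair of equal letters contributes the coefficient of w itself; the pairs of
different letters are grouped by the position j of the larger one, and
[swap_down_sum] applies. *)
Lemma sum_transpositions g w :
  (forall a b u, (a < b)%N -> raise S a b g u = 0) ->
  \sum_(j | S j) \sum_(i | S i && (i < j)%N) g (w # tperm i j) =
  (\sum_(j | S j) (#|[pred i | [&& S i, (i < j)%N & w i == w j]]|%:R
                    - (w j)%:R)) * g w.
Proof.
move=> g0.
under eq_bigr => j _ do rewrite (bigID (fun i => w i == w j)) /=.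
rewrite big_split /= mulr_suml.
under [RHS]eq_bigr => j _ do rewrite mulrBl.
rewrite sumrB; congr (_ + _).
  apply: eq_bigr => j _; rewrite mulr_natl -sumr_const.
  apply: congr_big => // [i|i /andP[_ /eqP wij]]; first by rewrite inE andbA.
  by rewrite mperm_tperm wij upd_id ?upd_id // updE; case: eqP => [->|].
under eq_bigr => j _ do rewrite (bigID (fun i => (w i < w j)%N)) /=.
rewrite big_split /= [X in _ + X](exchange_big_dep S) => [|j i _]; last first.
  by case/andP => /andP[/andP[]].
rewrite -big_split /= -sumrN; apply: eq_bigr => j Sj.
rewrite -mulNr -swap_down_sum // [RHS](bigID (fun i : 'I_n => (i < j)%N)) /=.
congr (_ + _).
  by apply: eq_bigl => i; case: (S i) => //=; lia.
under eq_bigr => i _ do rewrite tpermC.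
by apply: eq_bigl => i; case: (i =P j) => [->|/eqP]; rewrite ?Sj -?val_eqE /=;
  case: (S i) => //=; lia.
Qed.

End Casimir.

(** * Tableaux and their words *)
Section Cells.
Variables (lam : seq nat).
Implicit Types (c : cell lam).

Lemma cell_proof i j : (j < nth 0 lam i)%N -> (i < size lam)%N.
Proof. by move=> h; rewrite ltnNge; apply: contraTN h => /(nth_default 0) ->. Qed.

Definition mkcell i j (h : (j < nth 0 lam i)%N) : cell lam :=
  Tagged (fun i : 'I_(size lam) => 'I_(nth 0 lam i))
    (Ordinal h : 'I_(nth 0 lam (Ordinal (cell_proof h)))).

Lemma row_mkcell i j (h : (j < nth 0 lam i)%N) : crow (mkcell h) = i.
Proof. by []. Qed.

Lemma col_mkcell i j (h : (j < nth 0 lam i)%N) : ccol (mkcell h) = j.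
Proof. by []. Qed.

Lemma cell_ext c c' : crow c = crow c' -> ccol c = ccol c' -> c = c'.
Proof.
case: c c' => i j [i' j']; rewrite /crow /ccol /= => /val_inj ii'.
by case: _ / ii' j' => j' /val_inj ->.
Qed.

Lemma col_lt c : (ccol c < nth 0 lam (crow c))%N.
Proof. by case: c => i j; rewrite /crow /ccol /=. Qed.

Lemma card_row_below c :
  #|[pred c' : cell lam | (crow c' == crow c) && (ccol c' < ccol c)%N]| = ccol c.
Proof.
have lt_c (j : 'I_(ccol c)) : (j < nth 0 lam (crow c))%N.
  exact: ltn_trans (ltn_ord j) (col_lt c).
rewrite -[RHS]card_ord -(card_imset _ (f := fun j => mkcell (lt_c j))).
  apply: eq_card => c'; rewrite !inE; apply/andP/imsetP => [[/eqP rc lc]|].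
    by exists (Ordinal lc) => //; apply: cell_ext.
  by case=> j _ ->; rewrite row_mkcell col_mkcell eqxx ltn_ord.
by move=> j j' /(congr1 (@ccol lam)) e; apply: val_inj; apply: e.
Qed.

Lemma card_row a : #|[pred c : cell lam | crow c == a]| = nth 0 lam a.
Proof.
rewrite -[RHS]card_ord -(card_imset _ (f := fun j => mkcell (ltn_ord j))).
  apply: eq_card => c; rewrite !inE; apply/eqP/imsetP => [rc|].
    have lc : (ccol c < nth 0 lam a)%N by rewrite -rc col_lt.
    by exists (Ordinal lc) => //; apply: cell_ext.
  by case=> j _ ->.
by move=> j j' /(congr1 (@ccol lam)) e; apply: val_inj; apply: e.
Qed.

End Cells.

Section Tableaux.
Variables (lam : seq nat) (n : nat).
Implicit Types (t : tableau lam n) (T : std_tableau lam n) (w u : 'X_{1..n}).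

Lemma tab_inj t : injective t.
Proof. by case: t => f /= /andP[/injectiveP]. Qed.

Lemma tab_codom t k : k \in codom t.
Proof. by case: t => f /= /andP[_ /forallP]. Qed.

Definition cell_at t k : cell lam := iinv (tab_codom t k).

Lemma cell_atK t : cancel (cell_at t) t.
Proof. by move=> k; apply: f_iinv. Qed.

Lemma tabK t : cancel t (cell_at t).
Proof. by move=> c; apply: (@tab_inj t); rewrite cell_atK. Qed.

Lemma tab_bij t : bijective t.
Proof. by exists (cell_at t); [apply: tabK | apply: cell_atK]. Qed.

Lemma card_cell t : #|cell lam| = n.
Proof. by rewrite (bij_eq_card (tab_bij t)) card_ord. Qed.

Lemma tab_of_bij (f : cell lam -> 'I_n) :
  bijective f -> exists t : tableau lam n, t =1 f.
Proof.
move=> [g fK gK].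
have ok : injectiveb [ffun c => f c] && [forall k, k \in codom [ffun c => f c]].
  apply/andP; split; first by apply/injectiveP => c c'; rewrite !ffunE => /(can_inj fK).
  by apply/forallP => k; apply/codomP; exists (g k); rewrite ffunE gK.
by exists (Tableau ok) => c; rewrite /= ffunE.
Qed.

Lemma tab_eq t t' : t =1 t' -> t = t'.
Proof. by move=> e; apply: val_inj; apply/ffunP. Qed.

Definition word t : 'X_{1..n} := [multinom crow (cell_at t k) | k < n].

Lemma wordE t c : word t (t c) = crow c.
Proof. by rewrite mnmE tabK. Qed.

Definition has_weight w := forall a, cnt predT w a = nth 0 lam a.

Lemma has_weight_mperm w (s : 'S_n) : has_weight w -> has_weight (w # s).
Proof. by move=> ww a; rewrite cnt_mperm. Qed.

Lemma card_tab t (P : pred 'I_n) : #|P| = #|[pred c | P (t c)]|.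
Proof.
by rewrite -!sum1_card (reindex t) //; apply: onW_bij; apply: tab_bij.
Qed.

Lemma weight_word t : has_weight (word t).
Proof.
move=> a; rewrite /cnt (card_tab t) -card_row; apply: eq_card => c.
by rewrite !inE wordE.
Qed.

Lemma occ_lt w k : (occ w k < cnt predT w (w k))%N.
Proof.
rewrite /occ /cnt [X in (_ < X)%N](cardD1 k) !inE eqxx add1n ltnS.
apply: subset_leq_card; apply/subsetP => i; rewrite !inE => /andP[ik ->].
by rewrite andbT -val_eqE /= ltn_eqF.
Qed.

Lemma occ_mono w (k l : 'I_n) : w k = w l -> (k < l)%N -> (occ w k < occ w l)%N.
Proof.
move=> wkl kl; rewrite /occ [X in (_ < X)%N](cardD1 k) !inE kl wkl eqxx add1n ltnS.
apply: subset_leq_card; apply/subsetP => i; rewrite !inE => /andP[ik ->].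
by rewrite andbT -val_eqE /= ltn_eqF // (ltn_trans ik kl).
Qed.

(** The position k goes to row [w k], column [occ w k]: the rows of the
tableau list the positions of each letter in increasing order. *)
Lemma tab_of_word w : #|cell lam| = n -> has_weight w ->
  exists t : tableau lam n,
    forall c, w (t c) = crow c /\ occ w (t c) = ccol c.
Proof.
move=> cardc ww; have lt_k k : (occ w k < nth 0 lam (w k))%N.
  by rewrite -ww occ_lt.
pose g k := mkcell (lt_k k).
have g_inj : injective g.
  move=> k l gkl; have wkl : w k = w l by have := congr1 (@crow lam) gkl.
  have okl : occ w k = occ w l by have := congr1 (@ccol lam) gkl.
  case: (ltngtP k l) => [/(occ_mono wkl)|/(occ_mono (esym wkl))|/val_inj //];
    by rewrite okl ltnn.
have : bijective g by apply: inj_card_bij; rewrite // card_ord cardc.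
move=> [f gK fK]; have [t tE] : exists t : tableau lam n, t =1 f.
  by apply: tab_of_bij; exists g.
by exists t => c; rewrite tE -{2 4}(fK c).
Qed.

Lemma weight_mdeg w : #|cell lam| = n -> has_weight w ->
  mdeg w = (\sum_(c : cell lam) crow c)%N.
Proof.
move=> cardc /(tab_of_word cardc)[t tw]; rewrite mdegE.
rewrite (reindex t); last by apply: onW_bij; apply: tab_bij.
by apply: eq_bigr => c _; case: (tw c).
Qed.

Lemma weight_orbit w u : #|cell lam| = n -> has_weight w -> has_weight u ->
  exists s : 'S_n, u = w # s.
Proof.
move=> cardc /(tab_of_word cardc)[t tw] /(tab_of_word cardc)[t' tu].
have inj : injective (fun k => t (cell_at t' k)).
  exact: inj_comp (@tab_inj t) (can_inj (cell_atK t')).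
exists (perm inj); apply/mnmP => k; rewrite mnmE permE.
by rewrite (proj1 (tw _)) -(proj1 (tu _)) cell_atK.
Qed.

Lemma tab_orbit t t' : exists s : 'S_n, forall c, t' c = s (t c).
Proof.
have inj : injective (fun k => t' (cell_at t k)).
  exact: inj_comp (@tab_inj t') (can_inj (cell_atK t)).
by exists (perm inj) => c; rewrite permE tabK.
Qed.

Definition prefix (m : nat) : pred 'I_n := fun k => (k < m)%N.

(** The lattice words, also called Yamanouchi words. *)
Definition lattice_word w :=
  forall a b m, (a < b)%N -> (cnt (prefix m) w b <= cnt (prefix m) w a)%N.

Lemma occE w k : occ w k = cnt (prefix k) w (w k).
Proof. by []. Qed.

Lemma standardP t : reflect
  ((forall c c', crow c = crow c' -> (ccol c < ccol c')%N -> (t c < t c')%N) /\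
   (forall c c', ccol c = ccol c' -> (crow c < crow c')%N -> (t c < t c')%N))
  (is_standard t).
Proof.
apply: (iffP forallP) => [st|[rs cs] c].
  by split=> c c' e lt; have /forallP/(_ c') := st c;
    rewrite e lt eqxx ?orbT => /implyP->.
apply/forallP => c'; apply/implyP => /orP[]/andP[/eqP e lt].
  exact: rs.
exact: cs.
Qed.

(** Rows increase by construction.  If the entry k' of a cell were smaller than
the entry k of a cell higher in the same column j, the first k' + 1 letters
would contain j + 1 copies of the lower row and at most j of the upper one. *)
Lemma standard_of_lattice w t : lattice_word w ->
  (forall c, w (t c) = crow c /\ occ w (t c) = ccol c) -> is_standard t.
Proof.
move=> lw tw; apply/standardP; split=> c c' e lt; rewrite ltnNge leq_eqVlt.
  apply/negP => /orP[/eqP/val_inj/tab_inj cc'|].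
    by rewrite cc' ltnn in lt.
  have wcc : w (t c') = w (t c) by rewrite !(proj1 (tw _)).
  by move/(occ_mono wcc); rewrite !(proj2 (tw _)); lia.
apply/negP => /orP[/eqP/val_inj/tab_inj cc'|lt'].
  by rewrite cc' ltnn in lt.
have le1 : (cnt (prefix (t c').+1) w (crow c) <= ccol c)%N.
  rewrite -(proj2 (tw c)) occE (proj1 (tw c)); apply: subset_leq_card.
  by apply/subsetP => i; rewrite !inE /prefix => /andP[il ->]; rewrite andbT; lia.
have le2 : (ccol c' < cnt (prefix (t c').+1) w (crow c'))%N.
  rewrite -(proj2 (tw c')) occE (proj1 (tw c')) /cnt.
  rewrite [X in (_ < X)%N](cardD1 (t c')) !inE.
  rewrite {2}/prefix ltnSn (proj1 (tw c')) eqxx add1n ltnS.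
  apply: subset_leq_card; apply/subsetP => i; rewrite !inE /prefix.
  by case/andP=> il ->; rewrite andbT -val_eqE /= ltn_eqF // ltnW.
have := lw _ _ (t c').+1 lt; lia.
Qed.

Lemma occ_word T c : occ (word T) (T c) = ccol c.
Proof.
have /standardP[rs _] : is_standard T by case: T.
rewrite -card_row_below /occ (card_tab T); apply: eq_card => c'.
rewrite !inE !wordE andbC; case: eqP => //= e; apply/idP/idP; last exact: rs.
apply: contraTT; rewrite -!leqNgt leq_eqVlt => /orP[/eqP cc|/rs lt].
  by rewrite (cell_ext e (esym cc)).
by rewrite ltnW // lt.
Qed.

Lemma word_inj : injective (fun T => word T).
Proof.
move=> T T' e; apply/val_inj/tab_eq => c.
rewrite -[T c](cell_atK T'); congr (std_tab T' _); apply: cell_ext.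
  by rewrite -(wordE T') cell_atK -/(word T) -e wordE.
by rewrite -(occ_word T') cell_atK -e occ_word.
Qed.

End Tableaux.

(** * Leading words *)
Section LastFirstOrder.
Variable n : nat.
Implicit Types (w u v : 'X_{1..n}).

Definition rev_perm : 'S_n := perm (@rev_ord_inj n).

(** The last variable is the most significant one.  The leading word then
singles out a tail of letters, and what multiplies this tail is a form in the
first variables, on which the smaller symmetric groups act. *)
Definition prec u w := (u # rev_perm < w # rev_perm)%O.

Lemma mperm_revK : involutive (fun w => w # rev_perm).
Proof. by move=> w; apply/mnmP => i; rewrite !mnmE !permE rev_ordK. Qed.

Lemma prec_irr w : prec w w = false.
Proof. exact: ltxx. Qed.

Lemma prec_trans u v w : prec u v -> prec v w -> prec u w.
Proof. exact: lt_trans. Qed.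

Lemma prec_asym u w : prec u w -> prec w u -> False.
Proof. by move=> uw /(prec_trans uw); rewrite prec_irr. Qed.

Lemma precP u w : mdeg u = mdeg w -> reflect
  (exists2 k : 'I_n, forall j : 'I_n, (k < j)%N -> u j = w j & (u k < w k)%N)
  (prec u w).
Proof.
move=> duw; apply: (iffP (ltmcP _)); first by rewrite !mdeg_mperm.
  case=> i eq_i; rewrite !mnmE !permE => lt_i; exists (rev_ord i) => // j lt_j.
  have := eq_i (rev_ord j); rewrite !mnmE !permE rev_ordK; apply.
  by move: lt_j => /=; have := ltn_ord i; have := ltn_ord j; lia.
case=> k eq_k lt_k; exists (rev_ord k); last by rewrite !mnmE !permE rev_ordK.
move=> j /= lt_j; rewrite !mnmE !permE; apply: eq_k => /=.
by have := ltn_ord k; have := ltn_ord j; lia.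
Qed.

End LastFirstOrder.

Section LeadingWord.
Variables (n : nat) (F : numFieldType).
Implicit Types (w u v : 'X_{1..n}) (p q : {mpoly F[n]}).

Definition lead_word p : 'X_{1..n} := mlead (msym (rev_perm n) p) # rev_perm n.

Lemma msym_eq0 (s : 'S_n) p : (msym s p == 0) = (p == 0).
Proof. by rewrite -[RHS](inj_eq (@inj_msym _ _ s)) msym0. Qed.

Lemma lead_word_neq0 p : p != 0 -> p@_(lead_word p) != 0.
Proof. by move=> nz; rewrite /lead_word -mcoeff_sym mleadc_eq0 msym_eq0. Qed.

Lemma le_lead_word p u : p@_u != 0 -> u != lead_word p -> prec u (lead_word p).
Proof.
move=> nz ne; rewrite /prec /lead_word mperm_revK lt_neqAle.
rewrite -(inj_eq (can_inj (@mperm_revK n))) mperm_revK ne.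
by rewrite msupp_le_mlead // mcoeff_msupp mcoeff_sym mperm_revK.
Qed.

Lemma lead_word_eq p w : p@_w != 0 ->
  (forall u, p@_u != 0 -> u = w \/ prec u w) -> lead_word p = w.
Proof.
move=> nz max; have nzp : p != 0 by apply: contraNneq nz => ->; rewrite mcoeff0.
have [//|lt_w] := max _ (lead_word_neq0 nzp).
apply/eqP; rewrite eq_sym; apply: contraT => /(le_lead_word nz).
by move/(prec_asym lt_w).
Qed.

Lemma lead_word_prod (I : eqType) (r : seq I) (P : pred I)
    (f : I -> {mpoly F[n]}) :
  (forall i, P i -> f i != 0) ->
  lead_word (\prod_(i <- r | P i) f i) = (\sum_(i <- r | P i) lead_word (f i))%MM.
Proof.
move=> nz; rewrite /lead_word rmorph_prod /= mlead_prod_proper.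
  by apply/mnmP => k; rewrite mnmE !mnm_sumE; apply: eq_bigr => i _; rewrite mnmE.
move=> i _ Pi; apply/lregP.
by rewrite mleadc_eq0 msym_eq0 nz.
Qed.

Lemma subX_neq0 (a b : 'I_n) : a != b -> 'X_a - 'X_b != 0 :> {mpoly F[n]}.
Proof.
move=> ab; apply/eqP => /(congr1 (mcoeff U_(a)%MM)).
rewrite mcoeffB !mcoeffX mcoeff0 eqxx eq_mnm1 eq_sym (negPf ab) subr0.
by move/eqP; rewrite oner_eq0.
Qed.

Lemma lead_word_subX (a b : 'I_n) : (a < b)%N ->
  lead_word ('X_a - 'X_b : {mpoly F[n]}) = U_(b)%MM.
Proof.
move=> ab; have nab : (a == b) = false by rewrite -val_eqE ltn_eqF.
apply: lead_word_eq => [|u].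
  by rewrite mcoeffB !mcoeffX eqxx eq_mnm1 nab sub0r oppr_eq0 oner_eq0.
rewrite mcoeffB !mcoeffX; have [->|ne] := eqVneq U_(b)%MM u; first by left.
have [<- _|_] := eqVneq U_(a)%MM u; last by rewrite subrr eqxx.
right; apply/precP; first by rewrite !mdeg1.
exists b; last by rewrite !mnm1E nab eqxx.
by move=> j bj; rewrite !mnm1E -!val_eqE /= !ltn_eqF // (ltn_trans ab bj).
Qed.

End LeadingWord.

(** * Highest weight vectors *)
Section LetterCounts.
Variables (n : nat) (S : pred 'I_n).
Implicit Types (w u : 'X_{1..n}).

Lemma sum_letters (phi : nat -> nat) w u :
  (forall a, cnt S u a = cnt S w a) ->
  (\sum_(j | S j) phi (u j) = \sum_(j | S j) phi (w j))%N.
Proof.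
move=> uw; have letters (v : 'X_{1..n}) : (\sum_(j | S j) phi (v j) =
    \sum_(a <- [seq v j | j <- enum S]) phi a)%N.
  by rewrite big_map big_enum.
rewrite !letters; apply: perm_big; apply/allP => a _ /=; apply/eqP.
have countE (v : 'X_{1..n}) : count_mem a [seq v j | j <- enum S] = cnt S v a.
  rewrite count_map -size_filter /cnt cardE /enum_mem -filter_predI; congr size.
  by apply: eq_filter => j; rewrite !inE andbC.
by rewrite !countE.
Qed.

Definition earlier_equal w (j : 'I_n) : nat :=
  #|[pred i : 'I_n | [&& S i, (i < j)%N & w i == w j]]|.

(** Counts pairs of equal letters twice; the purpose is that the right-hand
side depends only on the multiplicities of the letters. *)
Lemma earlier_equal_double w :
  ((\sum_(j | S j) earlier_equal w j).*2 + \sum_(j | S j) 1 =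
   \sum_(j | S j) cnt S w (w j))%N.
Proof.
have later : (\sum_(j | S j) earlier_equal w j =
    \sum_(j | S j) #|[pred i : 'I_n | [&& S i, (j < i)%N & w i == w j]]|)%N.
  under eq_bigr => j _ do rewrite /earlier_equal -sum1_card.
  under [RHS]eq_bigr => j _ do rewrite -sum1_card.
  rewrite (exchange_big_dep S) /= => [|j i _ /and3P[]//]; apply: eq_bigr => j Sj.
  by apply: eq_bigl => i; rewrite !inE Sj eq_sym.
rewrite -addnn {2}later -!big_split /=; apply: eq_bigr => j Sj.
rewrite /cnt [RHS](cardD1 j) !inE Sj eqxx [RHS]addnC; congr (_ + _)%N.
rewrite -cardUI [X in (_ + X)%N]eq_card0 ?addn0 => [|i]; last first.
  by rewrite !inE; apply/negP => /andP[/and3P[_ ? _] /and3P[_ ? _]]; lia.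
apply: eq_card => i; rewrite !inE -val_eqE /=.
by case: (S i) => //=; case: (w i == w j); rewrite ?andbF ?andbT //; lia.
Qed.

Lemma earlier_equal_sum w u : (forall a, cnt S u a = cnt S w a) ->
  (\sum_(j | S j) earlier_equal u j = \sum_(j | S j) earlier_equal w j)%N.
Proof.
move=> uw; have e := earlier_equal_double.
have : (\sum_(j | S j) cnt S u (u j) = \sum_(j | S j) cnt S w (w j))%N.
  by under eq_bigr => j _ do rewrite uw; apply: (sum_letters (cnt S w)).
by rewrite -!e => /addIn/double_inj.
Qed.

End LetterCounts.

Section Highest.
Variables (lam : seq nat) (n : nat) (F : numFieldType).
Hypothesis card_n : #|cell lam| = n.
Implicit Types (w u v : 'X_{1..n}) (p q : {mpoly F[n]}).

Definition weighted p := forall w, p@_w != 0 -> has_weight lam w.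

(** Highest weight vectors of weight lam for the general linear Lie algebra. *)
Definition highest p := weighted p /\
  forall a b w, (a < b)%N -> raise predT a b (fun u => p@_u) w = 0.

Lemma weighted0 : weighted 0.
Proof. by move=> w; rewrite mcoeff0 eqxx. Qed.

Lemma weighted_lin a p q : weighted p -> weighted q -> weighted (a *: p + q).
Proof.
move=> wp wq w; rewrite mcoeffD mcoeffZ => nz.
have [p0|/wp//] := eqVneq p@_w 0; apply: wq.
by move: nz; rewrite p0 mulr0 add0r.
Qed.

Lemma weighted_msym (s : 'S_n) p : weighted p -> weighted (msym s p).
Proof.
move=> wp w; rewrite mcoeff_sym => /wp; rewrite -{2}(mpermKV s w).
exact: has_weight_mperm.
Qed.

Lemma highest0 : highest 0.
Proof.
by split=> [|a b w _]; [apply: weighted0 | apply: big1 => k _; rewrite mcoeff0].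
Qed.

Lemma highest_lin a p q : highest p -> highest q -> highest (a *: p + q).
Proof.
move=> [wp kp] [wq kq]; split=> [|c d w cd]; first exact: weighted_lin.
rewrite /raise; under eq_bigr => k _ do rewrite mcoeffD mcoeffZ.
rewrite big_split -mulr_sumr /=.
by move: (kp c d w cd) (kq c d w cd); rewrite /raise => -> ->; rewrite mulr0 addr0.
Qed.

Lemma highestZ a p : highest p -> highest (a *: p).
Proof. by move=> hp; rewrite -[_ *: _]addr0; apply: highest_lin => //; apply: highest0. Qed.

Lemma highestD p q : highest p -> highest q -> highest (p + q).
Proof. by move=> hp hq; rewrite -[p]scale1r; apply: highest_lin. Qed.

Lemma highestB p q : highest p -> highest q -> highest (p - q).
Proof. by move=> hp hq; rewrite addrC -scaleN1r; apply: highest_lin. Qed.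

Lemma highest_sum (I : Type) (r : seq I) (P : pred I) (f : I -> {mpoly F[n]}) :
  (forall i, P i -> highest (f i)) -> highest (\sum_(i <- r | P i) f i).
Proof. by move=> hf; apply: big_ind => //; [apply: highest0 | apply: highestD]. Qed.

Lemma highest_msym (s : 'S_n) p : highest p -> highest (msym s p).
Proof.
move=> [wp kp]; split=> [|a b w ab]; first exact: weighted_msym.
rewrite -[RHS](kp a b (w # s) ab) /raise [RHS](reindex_inj (@perm_inj _ s^-1%g)).
apply: congr_big => // k /=; first by rewrite mnmE permKV.
move=> _; rewrite mcoeff_sym; congr (_@_ _); apply/mnmP => i.
by rewrite !mnmE (can2_eq (permK s) (permKV s)).
Qed.

Definition tail_agrees m w u := [forall k : 'I_n, (m <= k)%N ==> (u k == w k)].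

Lemma tail_agreesP m w u :
  reflect (forall k : 'I_n, (m <= k)%N -> u k = w k) (tail_agrees m w u).
Proof.
by apply: (iffP forallP) => [h k /(implyP (h k))/eqP|h k];
  last by apply/implyP => /h ->.
Qed.

Lemma tail_agrees_upd m w u (k : 'I_n) b :
  (k < m)%N -> tail_agrees m w (upd u k b) = tail_agrees m w u.
Proof.
move=> km; apply: eq_forallb => i; rewrite updE.
by case: (i =P k) => [->|//]; rewrite leqNgt km.
Qed.

Lemma tail_agrees_tperm m w u (i j : 'I_n) :
  (i < m)%N -> (j < m)%N -> tail_agrees m w (u # tperm i j) = tail_agrees m w u.
Proof. by move=> im jm; rewrite mperm_tperm !tail_agrees_upd. Qed.

(** The coefficient of a tail of letters in p, as a tensor on the first m
positions. *)
Definition with_tail m w p u : F := if tail_agrees m w u then p@_u else 0.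

Lemma cnt_tail m w u a : tail_agrees m w u ->
  cnt predT u a = cnt predT w a -> cnt (prefix m) u a = cnt (prefix m) w a.
Proof.
move=> /tail_agreesP uw; have cut (v : 'X_{1..n}) : cnt predT v a =
    (cnt (prefix m) v a + #|[pred k : 'I_n | (m <= k)%N && (v k == a)]|)%N.
  rewrite /cnt -cardUI [X in (_ + X)%N]eq_card0 ?addn0 => [|i]; last first.
    by rewrite !inE /prefix; apply/negP => /andP[/andP[? _] /andP[? _]]; lia.
  by apply: eq_card => i; rewrite !inE /prefix /= -andb_orl ltnNge orNb.
rewrite !cut => /eqP; rewrite (eq_card (B := [pred k : 'I_n | (m <= k)%N && (w k == a)])).
  by rewrite eqn_add2r => /eqP.
by move=> k; rewrite !inE; case: leqP => //= /uw ->.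
Qed.

Section Leading.
Variables (p : {mpoly F[n]}) (m : nat).
Hypotheses (hp : highest p) (p0 : p != 0).
Let w := lead_word p.

Lemma lead_word_weight : has_weight lam w.
Proof. by apply: (proj1 hp); apply: lead_word_neq0. Qed.

Lemma prec_weightP u v : has_weight lam u -> has_weight lam v -> reflect
  (exists2 k : 'I_n, forall j : 'I_n, (k < j)%N -> u j = v j & (u k < v k)%N)
  (prec u v).
Proof. by move=> wu wv; apply: precP; rewrite !(weight_mdeg card_n). Qed.

(** A change of a letter a into b > a at a position of the tail would produce a
word above the leading one; so only the first m positions contribute to E_ab
on the words that share the tail of the leading word. *)
Lemma with_tail_killed a b u :
  (a < b)%N -> raise (prefix m) a b (with_tail m w p) u = 0.
Proof.
move=> ab; rewrite /raise /with_tail.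
under eq_bigr => k /andP[km _] do rewrite tail_agrees_upd //.
case: (boolP (tail_agrees m w u)) => [/tail_agreesP uw|_]; last by rewrite big1.
rewrite -[RHS](proj2 hp a b u ab) /raise [RHS](bigID (prefix m)) /=.
rewrite [X in _ = _ + X]big1 ?addr0 => [|k /andP[/eqP uk mk]].
  by apply: eq_bigl => k; rewrite andbC.
apply/eqP; apply: contraT => nz.
have wk : w k = a by rewrite -uw // leqNgt.
have wlt : prec w (upd u k b).
  apply/prec_weightP; [exact: lead_word_weight|exact: (proj1 hp)|].
  exists k; last by rewrite updE eqxx wk.
  move=> j kj; rewrite updE -val_eqE /= gtn_eqF // uw //.
  by move: mk; rewrite /prefix; lia.
have ne : upd u k b != w.
  by apply: contraTneq ab => /(congr1 (fun v : 'X_{1..n} => v k));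
    rewrite updE eqxx wk => ->; rewrite ltnn.
by case: (prec_asym wlt (le_lead_word nz ne)).
Qed.

Lemma with_tail_weight u a :
  with_tail m w p u != 0 -> cnt (prefix m) u a = cnt (prefix m) w a.
Proof.
rewrite /with_tail; case: ifP => [uw nz|_]; last by rewrite eqxx.
by apply: cnt_tail => //; rewrite lead_word_weight (proj1 hp).
Qed.

End Leading.

Lemma highest_lead_lattice p : highest p -> p != 0 -> lattice_word (lead_word p).
Proof.
move=> hp p0 a b m ab; rewrite leqNgt; apply/negP => lt_ab.
have := lead_word_neq0 p0; suff -> : p@_(lead_word p) = 0 by rewrite eqxx.
pose w := lead_word p.
have -> : p@_(lead_word p) = with_tail m w p w.
  by rewrite /with_tail ifT //; apply/tail_agreesP.
apply: (@raise_inj_lt _ _ (prefix m) a b (cnt (prefix m) w b - cnt (prefix m) w a)).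
- by rewrite ltn_eqF.
- by rewrite subn_gt0.
- by move=> u; apply: with_tail_killed.
by move=> u nz; rewrite !(with_tail_weight hp p0 _ nz) subnKC // ltnW.
Qed.

Definition jucys_murphy (k : 'I_n) p : {mpoly F[n]} :=
  \sum_(i < n | (i < k)%N) msym (tperm i k) p.

Definition word_content w (k : 'I_n) : F := (occ w k)%:R - (w k)%:R.

(** The sum involves only transpositions of the first m positions, which do
not change tails.  On the words with the tail of w it acts by the scalar of
[sum_transpositions]; the other words that occur have a smaller tail. *)
Lemma jm_partial_sum m p : highest p -> p != 0 -> 
  let w := lead_word p in
  forall u, (\sum_(j | prefix m j) jucys_murphy j p
             - (\sum_(j | prefix m j) word_content w j) *: p)@_u != 0 ->
  prec u w.
Proof.
move=> hp p0 w u; rewrite mcoeffB mcoeffZ raddf_sum /=.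
have -> : \sum_(j | prefix m j) (jucys_murphy j p)@_u =
    \sum_(j | prefix m j) \sum_(i | prefix m i && (i < j)%N) p@_(u # tperm i j).
  apply: eq_bigr => j jm; rewrite raddf_sum /=.
  apply: congr_big => // i; last by rewrite mcoeff_sym.
  by rewrite /prefix in jm *; lia.
case: (boolP (tail_agrees m w u)) => [uw|nuw].
  have -> : \sum_(j | prefix m j) \sum_(i | prefix m i && (i < j)%N)
      p@_(u # tperm i j) = (\sum_(j | prefix m j)
      ((earlier_equal (prefix m) u j)%:R - (u j)%:R)) * p@_u.
    have -> : p@_u = with_tail m w p u by rewrite /with_tail uw.
    rewrite -(sum_transpositions u (with_tail_killed m hp p0)).
    apply: eq_bigr => j jm; apply: eq_bigr => i /andP[im _].
    by rewrite /with_tail tail_agrees_tperm // uw.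
  rewrite -mulrBl; have [->|nz] := eqVneq p@_u 0.
    by rewrite mulr0 eqxx.
  have cuw a : cnt (prefix m) u a = cnt (prefix m) w a.
    by apply: (with_tail_weight hp p0); rewrite /with_tail uw.
  rewrite /word_content !sumrB -!natr_sum (earlier_equal_sum cuw).
  rewrite (sum_letters id cuw).
  suff -> : (\sum_(j | prefix m j) earlier_equal (prefix m) w j =
             \sum_(j | prefix m j) occ w j)%N.
    by rewrite subrr mul0r eqxx.
  apply: eq_bigr => j jm; apply: eq_card => i; rewrite !inE.
  by rewrite /prefix in jm *; case: (w i == w j); rewrite ?andbF ?andbT //; lia.
move=> nz.
have [v [nzv wu nvw vu]] : exists v, [/\ p@_v != 0, has_weight lam u, ~~ tail_agrees m w v &
    forall k : 'I_n, (m <= k)%N -> v k = u k].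
  have [pu|pu] := eqVneq p@_u 0; last by exists u; split=> //; apply: (proj1 hp).
  move: nz; rewrite pu mulr0 subr0 => nz.
  have [j jm nzj] : exists2 j : 'I_n, prefix m j &
      \sum_(i | prefix m i && (i < j)%N) p@_(u # tperm i j) != 0.
    apply/exists_inP; rewrite -negb_forall_in; apply: contra nz => /forall_inP z.
    by rewrite big1 // => i /z /eqP.
  have [i /andP[im _] nzi] : exists2 i : 'I_n, prefix m i && (i < j)%N &
      p@_(u # tperm i j) != 0.
    apply/exists_inP; rewrite -negb_forall_in; apply: contra nzj => /forall_inP z.
    by rewrite big1 // => l /z /eqP.
  exists (u # tperm i j); split=> //.
  - rewrite -(mpermKV (tperm i j) u); apply: has_weight_mperm.
    exact: (proj1 hp).
  - by rewrite tail_agrees_tperm.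
  move=> k mk; rewrite mnmE tpermD //; apply: contraTneq mk => <-;
    by rewrite -ltnNge.
have nev : v != w by apply: contraNneq nvw => ->; apply/tail_agreesP.
have /prec_weightP[||k eqk ltk] := le_lead_word nzv nev.
- exact: (proj1 hp).
- exact: lead_word_weight.
have mk : (m <= k)%N.
  rewrite leqNgt; apply: contra nvw => km; apply/tail_agreesP => j mj.
  by apply: eqk; lia.
apply/prec_weightP => //; first exact: lead_word_weight.
by exists k => [j kj|]; rewrite -vu // ?eqk //; lia.
Qed.

(** The k-th Jucys-Murphy element is the difference of two consecutive partial
sums. *)
Lemma jm_triangular k p : highest p -> p != 0 ->
  forall u, (jucys_murphy k p - word_content (lead_word p) k *: p)@_u != 0 ->
  prec u (lead_word p).
Proof.
move=> hp p0 u nz; have [e1|nz1] := eqVneq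
  (\sum_(j | prefix k.+1 j) jucys_murphy j p
   - (\sum_(j | prefix k.+1 j) word_content (lead_word p) j) *: p)@_u 0;
  last exact: jm_partial_sum nz1.
have [e2|nz2] := eqVneq
  (\sum_(j | prefix k j) jucys_murphy j p
   - (\sum_(j | prefix k j) word_content (lead_word p) j) *: p)@_u 0;
  last exact: jm_partial_sum nz2.
have cut (V : zmodType) (f : 'I_n -> V) :
    \sum_(j | prefix k.+1 j) f j = f k + \sum_(j | prefix k j) f j.
  rewrite (bigD1 k) /=; last exact: ltnSn.
  congr (_ + _); apply: eq_bigl => j.
  by rewrite /prefix -val_eqE /=; lia.
by rewrite !cut scalerDl opprD addrACA mcoeffD e2 addr0 in e1; rewrite e1 eqxx in nz.
Qed.

End Highest.

(** * Translation invariance *)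
Section TranslationInvariance.
Variables (n : nat) (F : numFieldType).
Implicit Types (p q : {mpoly F[n]}).

Lemma mpoly_alg_ind (Q : {mpoly F[n]} -> Prop) :
  (forall c, Q c%:MP) -> (forall i, Q 'X_i) ->
  (forall p q, Q p -> Q q -> Q (p + q)) ->
  (forall p q, Q p -> Q q -> Q (p * q)) -> forall p, Q p.
Proof.
move=> QC QX QD QM p; rewrite (mpolyE p).
have Q0 : Q 0 by rewrite -mpolyC0.
have Q1 : Q 1 by rewrite -mpolyC1.
apply: big_ind => // m _; rewrite -mul_mpolyC; apply: (QM) => //.
rewrite mpolyXE_id; apply: big_ind => // i _.
by elim: (m i) => [|k IH]; rewrite ?expr0 // exprS; apply: QM.
Qed.

(** The polynomial p (x_1 + t, ..., x_n + t) in t. *)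
Definition taylor p : {poly {mpoly F[n]}} :=
  mmap (polyC \o @mpolyC n F) (fun i => ('X_i)%:P + 'X) p.

Lemma taylorC c : taylor c%:MP = (c%:MP)%:P.
Proof. by rewrite /taylor mmapC. Qed.

Lemma taylorX i : taylor 'X_i = ('X_i)%:P + 'X.
Proof. by rewrite /taylor mmapX mmap1U. Qed.

Lemma taylorD p q : taylor (p + q) = taylor p + taylor q.
Proof. exact: mmapD. Qed.

Lemma taylorM p q : taylor (p * q) = taylor p * taylor q.
Proof. exact: (rmorphM (mmap _ _)). Qed.

Lemma taylor_horner a p :
  (taylor p).[a%:MP] = p \mPo [tuple 'X_i + a%:MP | i < n].
Proof.
elim/mpoly_alg_ind: p => [c|i|p q IHp IHq|p q IHp IHq].
- by rewrite taylorC hornerC comp_mpolyC.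
- by rewrite taylorX hornerD hornerC hornerX comp_mpolyXU -tnth_nth tnth_mktuple.
- by rewrite taylorD hornerD comp_mpolyD; move: (taylor p) (taylor q) IHp IHq => P Q -> ->.
- rewrite taylorM hornerM (rmorphM (comp_mpoly _)).
  by move: (taylor p) (taylor q) IHp IHq => P Q -> ->.
Qed.

Lemma taylor_deriv p :
  (taylor p).[0] = p /\ (taylor p)^`().[0] = \sum_k p^`M(k).
Proof.
elim/mpoly_alg_ind: p => [c|i|p q [p0 p1] [q0 q1]|p q [p0 p1] [q0 q1]].
- rewrite taylorC hornerC derivC hornerC big1 // => k _; exact: mderivC.
- rewrite taylorX derivD derivC derivX add0r !hornerE; split=> //.
  rewrite (bigD1 i) //= big1 ?addr0 => [|k ki]; rewrite mderivX mnm1E.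
    rewrite eqxx scale1r -mpolyX0; congr 'X_[_]; apply/mnmP => j.
    by rewrite mnmBE mnm0E subnn.
  by rewrite eq_sym (negPf ki) scale0r.
- rewrite taylorD derivD !hornerD.
  move: (taylor p) (taylor q) p0 p1 q0 q1 => P Q -> -> -> ->.
  by rewrite -big_split; split=> //; apply: eq_bigr => k _; rewrite mderivD.
- rewrite taylorM derivM hornerD !hornerM.
  move: (taylor p) (taylor q) p0 p1 q0 q1 => P Q -> -> -> ->; split=> //.
  under [RHS]eq_bigr => k _ do rewrite mderivM.
  by rewrite big_split mulr_suml mulr_sumr.
Qed.

(** [taylor p] takes the value p at infinitely many constants, so it is
constant, and its linear coefficient is the sum of the partial derivatives. *)
Lemma translation_invariant_deriv p :
  translation_invariant p -> \sum_k p^`M(k) = 0.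
Proof.
move=> tp; rewrite -(proj2 (taylor_deriv p)).
suff -> : taylor p = p%:P by rewrite derivC hornerC.
apply/eqP; rewrite -subr_eq0; set P := _ - _; apply/eqP.
apply: (@roots_geq_poly_eq0 _ _ [seq (i%:R)%:MP | i <- iota 0 (size P)]).
- apply/allP => _ /mapP[i _ ->]; rewrite /root /P hornerD hornerN hornerC.
  by rewrite taylor_horner tp subrr.
- rewrite map_inj_uniq ?iota_uniq // => i j /eqP.
  by rewrite mpolyC_eq eqr_nat => /eqP.
- by rewrite size_map size_iota.
Qed.

End TranslationInvariance.

(** * Columns and Vandermonde determinants *)
Section Columns.
Variables (lam : seq nat) (n : nat).
Hypothesis Hlam : is_partition lam n.
Implicit Types (c : cell lam).

Lemma count_sorted (s : seq nat) i j :
  sorted geq s -> (i < count (fun r => j < r) s)%N = (j < nth 0 s i)%N.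
Proof.
elim: s i => [|x s IH] i /=; first by rewrite nth_nil.
move=> ps; have ss := path_sorted ps.
have [jx|xj] := ltnP j x; first by case: i => [|i] /=; rewrite ?add1n ?ltnS ?IH ?jx.
have le_s y : y \in s -> (y <= x)%N.
  by move: ps; rewrite path_sortedE => [/andP[/allP h _]|a b d]; [apply: h|
     rewrite /geq /=; lia].
rewrite add0n (eq_in_count (a2 := pred0)) => [|y /le_s yx]; last first.
  by apply/negbTE; rewrite -leqNgt (leq_trans yx).
rewrite count_pred0; apply/esym/negbTE; rewrite -leqNgt.
case: i => [//|i] /=; have [lt|ge] := ltnP i (size s).
  by rewrite (leq_trans (le_s _ (mem_nth _ lt))).
by rewrite nth_default.
Qed.

Definition height j := count (fun r => j < r)%N lam.

Lemma heightP i j : (i < height j)%N = (j < nth 0 lam i)%N.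
Proof. by apply: count_sorted; case/and3P: Hlam. Qed.

Definition col_cell j (i : 'I_(height j)) : cell lam :=
  mkcell (etrans (esym (heightP i j)) (ltn_ord i)).

Lemma col_cell_inj j : injective (@col_cell j).
Proof. by move=> i i' /(congr1 (@crow lam)) e; apply: val_inj; apply: e. Qed.

Lemma col_col_cell j (i : 'I_(height j)) : ccol (col_cell i) = j.
Proof. by []. Qed.

Lemma col_cell_onto c : exists i : 'I_(height (ccol c)), c = col_cell i.
Proof.
have h : (crow c < height (ccol c))%N by rewrite heightP col_lt.
by exists (Ordinal h); apply: cell_ext.
Qed.

Lemma col_cell_image j : [set col_cell i | i : 'I_(height j)] = [set c | ccol c == j].
Proof.
apply/setP => c; rewrite inE; apply/imsetP/eqP => [[i _ ->] //|<-].
by have [i ->] := col_cell_onto c; exists i.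
Qed.

Lemma card_column j (P : pred (cell lam)) :
  #|[pred c | (ccol c == j) && P c]| = #|[pred i : 'I_(height j) | P (col_cell i)]|.
Proof.
rewrite -(card_imset _ (@col_cell_inj j)); apply: eq_card => c; rewrite inE.
apply/andP/imsetP => [[/eqP <- Pc]|[i Pi ->]].
  by have [i e] := col_cell_onto c; exists i => //; rewrite inE -e.
by rewrite col_col_cell eqxx.
Qed.

Lemma card_ord_lt h k : (k <= h)%N -> #|[pred i : 'I_h | (i < k)%N]| = k.
Proof.
move=> kh; rewrite -[RHS]card_ord -(card_imset _ (f := widen_ord kh)).
  apply: eq_card => i; rewrite !inE; apply/idP/imsetP => [ik|[i' _ ->]].
    by exists (Ordinal ik) => //; apply: val_inj.
  exact: (ltn_ord i').
by move=> i i' /(congr1 val) e; apply: val_inj.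
Qed.

Lemma card_rows_above c :
  #|[pred c' : cell lam | (ccol c' == ccol c) && (crow c' < crow c)%N]| = crow c.
Proof.
rewrite (card_column _ (fun c' => crow c' < crow c)%N) -[RHS](@card_ord_lt (height (ccol c))) //.
by rewrite ltnW // heightP col_lt.
Qed.

Lemma sum_columns a :
  (\sum_(j < nth 0 lam 0) (a < height j) = nth 0 lam a)%N.
Proof.
under eq_bigr => j _ do rewrite heightP.
rewrite -big_mkcond sum1_card card_ord_lt //.
have [//|lt] := leqP (nth 0%N lam a) (nth 0%N lam 0).
by have := heightP 0 (nth 0 lam 0)%N; have := heightP a (nth 0 lam 0)%N; lia.
Qed.

End Columns.

Section ProductSupport.
Variables (n : nat) (F : numFieldType).
Implicit Types (w u m : 'X_{1..n}).

Lemma coef_prod_neq0 (I : eqType) (r : seq I) (f : I -> {mpoly F[n]}) m :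
  uniq r -> (\prod_(i <- r) f i)@_m != 0 ->
  exists2 mm : I -> 'X_{1..n}, forall i, i \in r -> (f i)@_(mm i) != 0 &
    m = (\sum_(i <- r) mm i)%MM.
Proof.
elim: r m => [|i r IH] m /=.
  rewrite !big_nil mcoeff1 => _; case: (m =P 0%MM) => [-> _|]; last by rewrite eqxx.
  by exists (fun=> 0%MM) => //; rewrite big_nil.
rewrite big_cons => /andP[ir ur]; rewrite -mcoeff_msupp => /msuppM_le.
case/allpairsP=> -[m1 m2] [/= + + ->]; rewrite !mcoeff_msupp => nz1 /(IH _ ur).
case=> mm nz ->; exists (fun l => if l == i then m1 else mm l).
  by move=> l; rewrite inE; case: eqP => [-> //|_] /= /nz.
rewrite big_cons eqxx; congr (_ + _)%MM; rewrite !big_seq.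
by apply: eq_bigr => l lr; case: eqP => // li; rewrite -li lr in ir.
Qed.

(** In the determinant expansion, each term has the exponents 0, ..., h - 1 in
some order. *)
Lemma vandermonde_support h (f : 'I_h -> 'I_n) m : injective f ->
  (\prod_(i < h) \prod_(i' < h | (i < i')%N) ('X_(f i) - 'X_(f i')) :
    {mpoly F[n]})@_m != 0 ->
  (forall k, k \notin codom f -> m k = 0%N) /\
  exists s : 'S_h, forall i, m (f i) = s i.
Proof.
(* det_Vandermonde has factors a_j - a_i with i < j, whence the sign. *)
move=> f_inj; pose a : 'rV[{mpoly F[n]}]_h := \row_i (- 'X_(f i)).
have -> : \prod_(i < h) \prod_(i' < h | (i < i')%N) ('X_(f i) - 'X_(f i')) =
    \det (Vandermonde h a).
  rewrite det_Vandermonde; apply: eq_bigr => i _; apply: eq_bigr => i' _.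
  by rewrite !mxE opprK addrC.
rewrite raddf_sum /= => nz.
have [s nzs] : exists s : 'S_h,
    ((-1) ^+ s * \prod_i Vandermonde h a i (s i))@_m != 0.
  apply/existsP; rewrite -negb_forall; apply: contra nz => /forallP z.
  by rewrite big1 // => s _; apply/eqP.
have mE : m = (\sum_i U_(f (s i)) *+ i)%MM.
  apply/eqP; apply: contraNT nzs => ne.
  under eq_bigr => i _ do
    rewrite !mxE -mulN1r exprMn mpolyXn.
  rewrite big_split /= prodrXr /= mprodXE mulrA -exprD -mpolyC1 -mpolyCN -rmorphXn /=.
  rewrite mcoeffCM mcoeffX.
by move: ne; rewrite eq_sym => /negPf ->; rewrite mulr0.
have mk k : m k = (\sum_i (f (s i) == k) * i)%N.
  by rewrite mE mnm_sumE; apply: eq_bigr => i _; rewrite mulmnE mnm1E.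
split=> [k kf|].
  rewrite mk big1 // => i _; case: eqP => [e|]; rewrite ?mul0n //.
  by rewrite -e codom_f in kf.
exists (s^-1)%g => i; rewrite mk (bigD1 (s^-1 i)%g) //= permKV eqxx mul1n.
rewrite big1 ?addn0 // => i' ne; rewrite (inj_eq f_inj).
by rewrite (can2_eq (permK s) (permKV s)) (negPf ne) mul0n.
Qed.

End ProductSupport.

(** * Specht polynomials *)
Section Specht.
Variables (lam : seq nat) (n : nat) (F : numFieldType).
Implicit Types (t : tableau lam n) (T : std_tableau lam n).
Implicit Types (p q : {mpoly F[n]}) (w u : 'X_{1..n}).

(** The sum of the partial derivatives is the sum over c of c + 1 times the
action of E_(c,c+1).  These terms have pairwise different weights, so each of
them vanishes; the other E_ab with a < b follow by commutators. *)
Lemma highest_of_invariant p :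
  weighted lam p -> translation_invariant p -> highest lam p.
Proof.
move=> wp /translation_invariant_deriv dp; split=> // a b w.
apply: (raise_killed_trans (S := predT) (g := fun u => p@_u)) => {}a {}w.
(* The weight of a word that occurs in E_(c,c+1) p; it determines c. *)
have raise_cnt c : raise predT c c.+1 (fun u => p@_u) w != 0 ->
    [/\ cnt predT w c = (nth 0 lam c).+1%N,
        nth 0%N lam c.+1 = (cnt predT w c.+1).+1 &
        forall d, d != c -> d != c.+1 -> cnt predT w d = nth 0%N lam d].
  rewrite /raise => nz; have [k /andP[_ /eqP wk] nzk] :
      exists2 k, predT k && (w k == c) & p@_(upd w k c.+1) != 0.
    apply/exists_inP; rewrite -negb_forall_in; apply: contra nz => /forall_inP z.
    by rewrite big1 // => i /z /eqP.
  have wc : w k != c.+1 by rewrite wk ltn_eqF.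
  have W := wp _ nzk; split.
  - by rewrite -wk (@cnt_upd_old _ predT w k c.+1) // W wk.
  - by rewrite -W cnt_upd_new.
  - by move=> d dc dc1; rewrite -W cnt_upd_other // wk.
apply/eqP; apply: contraT => nz; have [wa wa1 _] := raise_cnt a nz.
have := congr1 (mcoeff w) dp; rewrite mcoeff0 raddf_sum /=.
pose N := \max_k w k.
have letter_sum : \sum_k (p^`M(k))@_w =
    \sum_(c < N.+1) c.+1%:R * raise predT c c.+1 (fun u => p@_u) w.
  rewrite /raise; under [RHS]eq_bigr => c _ do rewrite mulr_sumr.
  rewrite (exchange_big_dep predT) //=; apply: eq_bigr => k _.
  have wkN : (w k < N.+1)%N by rewrite ltnS (leq_bigmax k).
  rewrite (big_pred1 (Ordinal wkN)) => [/=|c]; last by rewrite eq_sym.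
  rewrite mcoeff_deriv mulr_natl; congr (p@_ _ *+ _); apply/mnmP => i.
  rewrite mnmDE mnm1E updE eq_sym; case: eqP => [->|_]; first by rewrite addn1.
  by rewrite addn0.
have [aN|aN] := ltnP a N.+1; last first.
  have : (0 < cnt predT w a)%N by rewrite wa.
  by case/card_gt0P => k; rewrite !inE => /eqP wk;
     have := @leq_bigmax _ w k; rewrite -/N wk; lia.
rewrite letter_sum (bigD1 (Ordinal aN)) //= big1 ?addr0 => [/eqP|c].
  by rewrite mulf_eq0 (negPf nz) orbF pnatr_eq0.
rewrite -val_eqE /= => ca; apply/eqP; rewrite mulf_eq0; apply/orP; right.
apply: contraT => /raise_cnt[wc wc1 wd].
have [e|ne] := eqVneq (a : nat) c.+1.
  by move: wc1; rewrite -e wa => ?; lia.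
have := wd a; rewrite eq_sym ca ne wa => /(_ isT isT); lia.
Qed.

Lemma specht_orbit t t' : exists s : 'S_n,
  specht_poly F t' = msym s (specht_poly F t).
Proof.
have [s ts] := tab_orbit t t'; exists s; rewrite /specht_poly rmorph_prod /=.
apply: eq_bigr => c _; rewrite rmorph_prod; apply: eq_bigr => c' _ /=.
by rewrite msymB /msym !mmapX !mmap1U !ts.
Qed.

Lemma specht_neq0 t : specht_poly F t != 0.
Proof.
apply/prodf_neq0 => c _; apply/prodf_neq0 => c' /andP[_ lt].
by apply: subX_neq0; apply: contraTneq lt => /tab_inj ->; rewrite ltnn.
Qed.

Lemma specht_invariant t : translation_invariant (specht_poly F t).
Proof.
move=> a; rewrite /specht_poly rmorph_prod; apply: eq_bigr => c _.
rewrite rmorph_prod; apply: eq_bigr => c' _ /=.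
rewrite rmorphB /= !comp_mpolyXU -!tnth_nth !tnth_mktuple.
by rewrite opprD addrACA subrr addr0.
Qed.

(** A factor for two cells of a column contributes the variable of the lower
cell, which has the larger entry; a cell in row i is the lower cell of i
pairs. *)
Lemma lead_word_specht T : is_partition lam n ->
  lead_word (specht_poly F T) = word T.
Proof.
move=> Hlam; have /standardP[_ cs] : is_standard T by case: T.
rewrite /specht_poly lead_word_prod => [|c _]; last first.
  apply/prodf_neq0 => c' /andP[_ lt].
  by apply: subX_neq0; apply: contraTneq lt => /tab_inj ->; rewrite ltnn.
apply/mnmP => k; rewrite mnm_sumE -[k](cell_atK T); set c0 := cell_at T k.
rewrite wordE -[RHS](card_rows_above Hlam) -sum1_card [RHS]big_mkcond /=.
apply: eq_bigr => c _; rewrite lead_word_prod => [|c' /andP[_ lt]]; last first.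
  by apply: subX_neq0; apply: contraTneq lt => /tab_inj ->; rewrite ltnn.
rewrite mnm_sumE inE.
transitivity (\sum_(c' | (ccol c == ccol c') && (crow c < crow c')%N) (c' == c0))%N.
  apply: eq_bigr => c' /andP[/eqP e lt].
  by rewrite lead_word_subX ?cs // mnm1E (inj_eq (@tab_inj _ _ T)).
rewrite -big_mkcondr sum1_card.
case: ifP => [h|h]; last first.
  apply: eq_card0 => c'; rewrite unfold_in; apply/negP => /andP[h' /eqP e].
  by rewrite e h in h'.
rewrite -(card1 c0); apply: eq_card => c'; rewrite !inE unfold_in.
by case: (c' =P c0) => [->|_]; rewrite ?andbF // h.
Qed.

(** A monomial has in the column j the exponents 0, ..., height j - 1 in some
order, so the exponent a occurs once for each column longer than a, which is
lam_a times. *)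
Lemma weighted_specht t : is_partition lam n -> weighted lam (specht_poly F t).
Proof.
move=> Hlam m.
have col_lt0 (c : cell lam) : (ccol c < nth 0 lam 0)%N.
  by have := heightP Hlam (crow c) (ccol c); rewrite col_lt -(heightP Hlam); lia.
pose cord c := Ordinal (col_lt0 c).
pose V (j : 'I_(nth 0 lam 0)) : {mpoly F[n]} :=
  \prod_(i < height lam j) \prod_(i' < height lam j | (i < i')%N)
    ('X_(t (col_cell Hlam i)) - 'X_(t (col_cell Hlam i'))).
have inj_col (j : 'I_(nth 0 lam 0)) :
    injective (fun i : 'I_(height lam j) => t (col_cell Hlam i)).
  exact: inj_comp (@tab_inj _ _ t) (@col_cell_inj _ _ Hlam j).
have -> : specht_poly F t = \prod_j V j.
  rewrite /specht_poly (partition_big cord predT) //=; apply: eq_bigr => j _.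
  have colE c : (cord c == j) = (c \in [set c | ccol c == j]) by rewrite inE.
  rewrite (eq_bigl _ _ colE) -(col_cell_image Hlam) big_imset /=; last first.
    by move=> i i' _ _; apply: col_cell_inj.
  apply: eq_bigr => i _; rewrite big_mkcond /=.
  rewrite (bigID (fun c' => c' \in [set c | ccol c == j])) /=.
  rewrite [X in _ * X]big1 ?mulr1 => [|c']; last first.
    by rewrite inE => /negPf; rewrite col_col_cell eq_sym => ->.
  rewrite -(col_cell_image Hlam) big_imset /=; last first.
    by move=> i1 i2 _ _; apply: col_cell_inj.
  rewrite [RHS]big_mkcond; apply: eq_bigr => i' _.
  by rewrite !col_col_cell eqxx.
move/(coef_prod_neq0 (index_enum_uniq _)) => [mm nz mE].
have colsupp j := vandermonde_support (@inj_col j) (nz j (mem_index_enum j)).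
have mc c : m (t c) = mm (cord c) (t c).
  rewrite mE mnm_sumE (bigD1 (cord c)) //= big1 ?addn0 // => j jc.
  apply: (proj1 (colsupp j)); apply: contra jc => /codomP[i /tab_inj ci].
  by rewrite -val_eqE /= ci col_col_cell.
move=> a; rewrite /cnt (card_tab t) -sum1_card (partition_big cord predT) //=.
rewrite -[RHS](sum_columns Hlam); apply: eq_bigr => j _; rewrite sum1_card.
have [_ [s ms]] := colsupp j.
transitivity #|[pred i : 'I_(height lam j) | s i == a :> nat]|.
  transitivity #|[pred c | (ccol c == j) && (mm j (t c) == a)]|.
    apply: eq_card => c; rewrite unfold_in /= inE mc -[cord c == j]val_eqE /=.
    rewrite andbC inE; case: eqP => //= e; congr (fun_of_multinom (mm _) _ == _).
    exact: val_inj.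
  rewrite (card_column Hlam j (fun c => mm j (t c) == a)).
  by apply: eq_card => i; rewrite !inE ms.
case: ltnP => [ah|ha]; last first.
  by apply: eq_card0 => i; rewrite !inE ltn_eqF // (leq_trans (ltn_ord _)).
rewrite (eq_card (B := pred1 (s^-1 (Ordinal ah))%g)) ?card1 // => i; rewrite !inE.
by rewrite -(can2_eq (permK s) (permKV s)).
Qed.

Lemma highest_specht t : is_partition lam n -> highest lam (specht_poly F t).
Proof.
by move=> Hlam; apply: highest_of_invariant;
  [apply: weighted_specht | apply: specht_invariant].
Qed.

End Specht.

(** * Forms of weight lam *)
Section Spans.
Variables (F : fieldType) (V : lmodType F) (I : finType) (P : pred I) (f : I -> V).

Lemma in_span_gen i : P i -> in_span P f (f i).
Proof.
move=> Pi; exists (fun j => (j == i)%:R); rewrite (bigD1 i) //= eqxx scale1r.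
by rewrite big1 ?addr0 // => j /andP[_ /negPf ->]; rewrite scale0r.
Qed.

Lemma in_span_lin a u v : in_span P f u -> in_span P f v -> in_span P f (a *: u + v).
Proof.
move=> [b ->] [c ->]; exists (fun i => a * b i + c i).
rewrite scaler_sumr -big_split; apply: eq_bigr => i _ /=.
by rewrite scalerA scalerDl.
Qed.

Lemma in_span0 : in_span P f 0.
Proof. by exists (fun=> 0); rewrite big1 // => i _; rewrite scale0r. Qed.

Lemma in_span_sum (J : Type) (r : seq J) (Q : pred J) (b : J -> F) (g : J -> V) :
  (forall j, Q j -> in_span P f (g j)) ->
  in_span P f (\sum_(j <- r | Q j) b j *: g j).
Proof.
move=> fg; elim/big_rec: _ => [|j v Qj]; first exact: in_span0.
by apply: in_span_lin; apply: fg.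
Qed.

End Spans.

Section FormsOfTypeLambda.
Variables (lam : seq nat) (n : nat) (F : numFieldType).
Hypothesis card_n : #|cell lam| = n.
Implicit Types (p : {mpoly F[n]}) (m : 'X_{1..n}).

(** The positive letters are counted through the cells below the first row; the
letter 0 gets all the remaining positions, as many as there are cells in the
first row. *)
Lemma Xmon_weighted (y : {ffun lower_cell lam -> 'I_n}) :
  injective y -> weighted lam (Xmon F y).
Proof.
move=> y_inj m; rewrite /Xmon.
under eq_bigr => c _ do rewrite mpolyXn.
rewrite mprodXE mcoeffX pnatr_eq0 eqb0 negbK => /eqP <-.
set w := (\sum_c _)%MM.
have wE k : w k = (\sum_c (y c == k) * crow (val c))%N.
  by rewrite mnm_sumE; apply: eq_bigr => c _; rewrite mulmnE mnm1E.
have wy c : w (y c) = crow (val c).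
  rewrite wE (bigD1 c) //= eqxx mul1n big1 ?addn0 // => c' c'c.
  by rewrite (inj_eq y_inj) (negPf c'c).
have w0 k : k \notin codom y -> w k = 0%N.
  move=> ky; rewrite wE big1 // => c _; case: eqP => [e|//].
  by rewrite -e codom_f in ky.
have lower a : (0 < a)%N -> cnt predT w a = nth 0%N lam a.
  move=> a0; rewrite -card_row /cnt.
  have -> : #|[pred k | predT k && (w k == a)]| =
            #|[pred c : lower_cell lam | crow (val c) == a]|.
    rewrite -(card_imset _ y_inj); apply: eq_card => k; rewrite !inE /=.
    apply/eqP/imsetP => [wk|[c]]; last by rewrite inE => /eqP <- ->; rewrite wy.
    have /codomP[c kc] : k \in codom y.
      by apply: contraTT a0 => /w0; rewrite wk => ->.
    by exists c => //; rewrite inE -wy -kc wk.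
  rewrite -(card_imset _ val_inj); apply: eq_card => c; rewrite !inE /=.
  apply/imsetP/eqP => [[c' + ->]|rc]; first by rewrite inE => /eqP.
  have h : (0 < crow c)%N by rewrite rc.
  by exists (Sub c h); rewrite ?inE SubK // rc.
case=> [|a]; last exact: lower.
have total (v : 'I_n -> nat) : (#|[pred k | v k == 0%N]| + #|[pred k | v k != 0%N]| = n)%N.
  by rewrite -[RHS]card_ord -(cardC [pred k | v k == 0%N]).
have nonzero : #|[pred k | w k != 0%N]| = #|[pred c : cell lam | crow c != 0%N]|.
  transitivity #|lower_cell lam|.
    rewrite -(card_codom y_inj); apply: eq_card => k; rewrite !inE.
    apply/idP/idP => [|/codomP[c ->]]; first by apply: contraNT => /w0 ->.
    by rewrite wy -lt0n; apply: (valP c).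
  by rewrite card_sig; apply: eq_card => c; rewrite !inE lt0n.
have zero : (#|[pred c : cell lam | crow c == 0%N]| +
             #|[pred c : cell lam | crow c != 0%N]| = n)%N.
  by rewrite -card_n -(cardC [pred c : cell lam | crow c == 0%N]).
have := etrans (total (fun k => w k)) (esym zero).
rewrite nonzero card_row => /addIn <-.
by apply: eq_card.
Qed.

Lemma in_L_weighted p : in_L lam p <-> weighted lam p.
Proof.
split=> [[a ->]|wp].
  elim/big_rec: _ => [|y q /injectiveP yi]; first exact: weighted0.
  by apply: weighted_lin; apply: Xmon_weighted.
rewrite (mpolyE p) big_seq; apply: in_span_sum => m.
rewrite mcoeff_msupp => /wp /(tab_of_word card_n)[t tm].
pose y := [ffun c : lower_cell lam => t (val c)].
have y_inj : injective y.
  by move=> c c'; rewrite !ffunE => /tab_inj; apply: val_inj.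
have -> : 'X_[m] = Xmon F y; last by apply: in_span_gen; apply/injectiveP.
rewrite mpolyXE_id (reindex t); last by apply: onW_bij; apply: tab_bij.
rewrite (bigID (fun c => 0 < crow c)%N) /= [X in _ * X]big1 ?mulr1; last first.
  by move=> c; rewrite -eqn0Ngt (proj1 (tm c)) => /eqP ->; rewrite expr0.
rewrite /Xmon (big_sub (fun c => 0 < crow c)%N) /=.
by apply: eq_bigr => c _; rewrite ffunE (proj1 (tm _)).
Qed.

End FormsOfTypeLambda.

(** * The basis of standard Specht polynomials *)
Section Basis.
Variables (lam : seq nat) (n : nat) (F : numFieldType).
Hypotheses (Hlam : is_partition lam n) (t0 : tableau lam n).
Local Notation ST := (std_tableau lam n).
Local Notation SP T := (specht_poly F (std_tab T)).
Local Notation highest := (@highest lam n F).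
Implicit Types (p q : {mpoly F[n]}) (T : ST) (a : ST -> F).

Lemma highest_lead_word p : highest p -> p != 0 ->
  exists T : ST, lead_word p = word T.
Proof.
move=> hp p0; have lw := highest_lead_lattice (card_cell t0) hp p0.
have ww := lead_word_weight hp p0.
have [t tw] := tab_of_word (card_cell t0) ww.
exists (StdTableau (standard_of_lattice lw tw)) => /=.
by apply/mnmP => k; rewrite -[k](cell_atK t) wordE (proj1 (tw _)).
Qed.

Lemma highest_eq0 p : highest p -> (forall T : ST, p@_(word T) = 0) -> p = 0.
Proof.
move=> hp p0; apply/eqP; apply: contraT => nz.
have [T eT] := highest_lead_word hp nz.
by have := lead_word_neq0 nz; rewrite eT p0 eqxx.
Qed.

Lemma specht_lead_coef T : (SP T)@_(word T) != 0.
Proof. by rewrite -(lead_word_specht F T Hlam) lead_word_neq0 ?specht_neq0. Qed.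

Lemma specht_coef T u : (SP T)@_u != 0 -> u = word T \/ prec u (word T).
Proof.
move=> nz; have [->|ne] := eqVneq u (word T); [by left | right].
rewrite -(lead_word_specht F T Hlam); apply: le_lead_word => //.
by rewrite lead_word_specht.
Qed.

Definition comb a : {mpoly F[n]} := \sum_T a T *: SP T.

(** Among the tableaux with a nonzero coefficient, the one with the largest word
cannot be cancelled by the others. *)
Lemma comb_lead a T0 : a T0 != 0 ->
  exists T, [/\ a T != 0, comb a != 0, lead_word (comb a) = word T &
     forall T', a T' != 0 -> T' = T \/ prec (word T') (word T)].
Proof.
move=> nz0.
case: (@Order.TotalTheory.arg_maxP _ _ _ T0 (fun T => a T != 0)
         (fun T => word T # rev_perm n) nz0) => T nzT maxT.
have max T' : a T' != 0 -> T' = T \/ prec (word T') (word T).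
  move=> /maxT /=; rewrite le_eqVlt => /orP[/eqP e|]; [left | by right].
  exact/word_inj/(can_inj (@mperm_revK n)).
have coefE u : (comb a)@_u = \sum_T a T * (SP T)@_u.
  by rewrite raddf_sum; apply: eq_bigr => T' _; rewrite /= mcoeffZ.
have topE : (comb a)@_(word T) = a T * (SP T)@_(word T).
  rewrite coefE (bigD1 T) //= big1 ?addr0 // => T' T'T.
  apply/eqP; apply: contraT; rewrite mulf_eq0 negb_or => /andP[nz' /specht_coef].
  have [e|lt] := max _ nz'; first by rewrite e eqxx in T'T.
  by case=> [/word_inj e|/(prec_asym lt)//]; rewrite e eqxx in T'T.
have top_nz : (comb a)@_(word T) != 0.
  by rewrite topE mulf_neq0 // specht_lead_coef.
exists T; split=> //; first by apply: contraNneq top_nz => ->; rewrite mcoeff0.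
apply: lead_word_eq => // u; rewrite coefE => nzu.
have [T' nz' nzu'] : exists2 T', a T' != 0 & (SP T')@_u != 0.
  have [T' h] : exists T', a T' * (SP T')@_u != 0.
    apply/existsP; rewrite -negb_forall; apply: contra nzu => /forallP z.
    by rewrite big1 // => T' _; apply/eqP.
  by exists T'; apply: contraNneq h => ->; rewrite ?mul0r ?mulr0.
have := specht_coef nzu'; have [->|lt] := max _ nz' => //.
by case=> [->|lt']; right => //; apply: prec_trans lt' lt.
Qed.

Lemma specht_free a : comb a = 0 -> forall T, a T = 0.
Proof.
move=> z T; apply/eqP; apply: contraT => /comb_lead[T' [_]].
by rewrite z eqxx.
Qed.

Lemma highest_comb a : highest (comb a).
Proof.
apply: highest_sum => T _; apply: highestZ.
exact: highest_specht.
Qed.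

Local Notation d := #|{: ST}|.

(** The coefficients of the standard Specht polynomials at the words of the
standard tableaux.  A highest weight vector is determined by its coefficients
at these words, so inverting this matrix gives its coordinates. *)
Definition eval_mx : 'M[F]_d :=
  \matrix_(i, j) (SP (enum_val i : ST))@_(word (enum_val j : ST)).

Definition of_coords (v : 'rV[F]_d) : {mpoly F[n]} :=
  \sum_i v 0 i *: SP (enum_val i : ST).

Definition coords p : 'rV[F]_d :=
  \row_j p@_(word (enum_val j : ST)) *m invmx eval_mx.

Lemma of_coordsE v : of_coords v = \sum_i v 0 i *: SP (enum_val i : ST).
Proof. by []. Qed.

Lemma of_coords_comb v : of_coords v = comb (fun T => v 0 (enum_rank T)).
Proof.
rewrite /of_coords /comb (reindex (@enum_rank ST)) /=; last first.
  by apply: onW_bij; apply: enum_rank_bij.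
by apply: eq_bigr => T _; rewrite enum_rankK.
Qed.

Lemma of_coords_linear : linear of_coords.
Proof.
move=> c u v; rewrite /of_coords scaler_sumr -big_split; apply: eq_bigr => i _ /=.
by rewrite !mxE scalerA scalerDl.
Qed.

Lemma of_coords_eval v :
  \row_j (of_coords v)@_(word (enum_val j : ST)) = v *m eval_mx.
Proof.
apply/rowP => j; rewrite !mxE raddf_sum; apply: eq_bigr => i _ /=.
by rewrite mcoeffZ mxE.
Qed.

Lemma highest_of_coords v : highest (of_coords v).
Proof. by rewrite of_coords_comb; apply: highest_comb. Qed.

Lemma of_coords_inj : injective of_coords.
Proof.
move=> u v e; apply/eqP; rewrite -subr_eq0; apply/eqP/rowP => i; rewrite [RHS]mxE.
have z : of_coords (u - v) = 0.
  by rewrite addrC -scaleN1r of_coords_linear e scaleN1r addNr.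
move: z; rewrite of_coords_comb => /specht_free /(_ (enum_val i)).
by rewrite enum_valK.
Qed.

Lemma eval_mx_unit : eval_mx \in unitmx.
Proof.
rewrite unitmxE unitfE; apply/negP => /det0P[v nz z].
have /eqP[] := nz; apply: of_coords_inj.
rewrite [RHS]big1 => [|i _]; last by rewrite mxE scale0r.
apply: highest_eq0 (highest_of_coords v) _ => T.
have /rowP/(_ (enum_rank T)) := of_coords_eval v.
by rewrite z !mxE enum_rankK.
Qed.

Lemma coordsK p : highest p -> of_coords (coords p) = p.
Proof.
move=> hp; apply/eqP; rewrite -subr_eq0; apply/eqP/highest_eq0.
  by apply: highestB => //; apply: highest_of_coords.
move=> T; have /rowP/(_ (enum_rank T)) := of_coords_eval (coords p).
rewrite /coords mulmxKV ?eval_mx_unit // !mxE enum_rankK mcoeffB => ->.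
by rewrite subrr.
Qed.

Lemma highest_specht_span p : highest p <-> in_span predT (fun T : ST => SP T) p.
Proof.
split=> [hp|[a ->]]; last exact: highest_comb.
by exists (fun T => coords p 0 (enum_rank T)); rewrite -[LHS](coordsK hp) of_coords_comb.
Qed.

Lemma in_spechtP p : in_specht t0 p <-> highest p.
Proof.
split=> [[a ->]|/highest_specht_span[a ->]].
  apply: highest_sum => s _; apply: highestZ; apply: highest_msym.
  exact: highest_specht.
apply: in_span_sum => T _; have [s ->] := specht_orbit F t0 T.
exact: in_span_gen.
Qed.

Lemma highest_invariant p : highest p -> translation_invariant p.
Proof.
move=> /highest_specht_span[a ->] c; rewrite raddf_sum; apply: eq_bigr => T _.
by rewrite /= comp_mpolyZ specht_invariant.
Qed.

End Basis.

(** * The invariant form and the orthogonal basis *)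
Section InvariantForm.
Variables (lam : seq nat) (n : nat) (C : numClosedFieldType).
Hypotheses (Hlam : is_partition lam n) (t0 : tableau lam n).
Local Notation ST := (std_tableau lam n).
Local Notation SP T := (specht_poly C (std_tab T)).
Local Notation highest := (@highest lam n C).
Local Notation comb := (@comb lam n C).
Implicit Types (p q r : {mpoly C[n]}) (T : ST).

(** The words of weight lam form one orbit of the symmetric group; summing over
the group rather than over the orbit multiplies the standard hermitian form by
a positive constant and makes the invariance a change of variable. *)
Definition form p q : C :=
  \sum_(s : 'S_n) p@_(word t0 # s) * (q@_(word t0 # s))^*.

Lemma formDl p q r : form (p + q) r = form p r + form q r.
Proof. by rewrite -big_split; apply: eq_bigr => s _ /=; rewrite mcoeffD mulrDl. Qed.

Lemma formZl c p r : form (c *: p) r = c * form p r.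
Proof. by rewrite mulr_sumr; apply: eq_bigr => s _ /=; rewrite mcoeffZ mulrA. Qed.

Lemma form0l r : form 0 r = 0.
Proof. by rewrite -(scale0r 0) formZl mul0r. Qed.

Lemma formC p q : form q p = (form p q)^*.
Proof.
rewrite /form rmorph_sum; apply: eq_bigr => s _ /=.
by rewrite rmorphM /= conjCK mulrC.
Qed.

Lemma formDr p q r : form r (p + q) = form r p + form r q.
Proof. by rewrite !(formC _ r) formDl rmorphD. Qed.

Lemma formZr c p r : form r (c *: p) = c^* * form r p.
Proof. by rewrite !(formC _ r) formZl rmorphM. Qed.

Lemma form0r r : form r 0 = 0.
Proof. by rewrite formC form0l rmorph0. Qed.

Lemma form_suml (I : Type) (s : seq I) (P : pred I) (f : I -> {mpoly C[n]}) r :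
  form (\sum_(i <- s | P i) f i) r = \sum_(i <- s | P i) form (f i) r.
Proof. by apply: (big_morph (fun p => form p r) _ (form0l r)) => p q; apply: formDl. Qed.

Lemma form_sumr (I : Type) (s : seq I) (P : pred I) (f : I -> {mpoly C[n]}) r :
  form r (\sum_(i <- s | P i) f i) = \sum_(i <- s | P i) form r (f i).
Proof. by apply: (big_morph (form r) _ (form0r r)) => p q; apply: formDr. Qed.

Lemma form_eq0 p : highest p -> form p p = 0 -> p = 0.
Proof.
move=> [wp _] z; apply/mpolyP => m; rewrite mcoeff0.
apply/eqP; apply: contraT => nz.
have [s ms] := weight_orbit (card_cell t0) (weight_word t0) (wp _ nz).
have /psumr_eq0P/(_ z)/(_ s isT)/eqP : forall s : 'S_n, true ->
    0 <= p@_(word t0 # s) * (p@_(word t0 # s))^*.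
  by move=> s' _; rewrite mul_conjC_ge0.
by rewrite mul_conjC_eq0 -ms (negPf nz).
Qed.

Lemma form_msym (s : 'S_n) p q : form (msym s p) (msym s q) = form p q.
Proof.
rewrite /form [RHS](reindex_inj (mulgI s)); apply: eq_bigr => s' _ /=.
by rewrite !mcoeff_sym mpermM.
Qed.

Lemma form_msym_adj (s : 'S_n) p q : form (msym s p) q = form p (msym s^-1 q).
Proof. by rewrite -(form_msym s^-1) -msymMm mulgV msym1m. Qed.

Lemma form_jm k p q : form (jucys_murphy k p) q = form p (jucys_murphy k q).
Proof.
rewrite /jucys_murphy form_suml form_sumr; apply: eq_bigr => i _.
by rewrite form_msym_adj tpermV.
Qed.

Lemma highest_jm k p : highest p -> highest (jucys_murphy k p).
Proof. by move=> hp; apply: highest_sum => i _; apply: highest_msym. Qed.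

Definition below (W : 'X_{1..n}) (a : ST -> C) :=
  forall T, a T != 0 -> prec (word T) W.

Lemma comb_below W a : (forall w, (comb a)@_w != 0 -> prec w W) -> below W a.
Proof.
move=> lt T nz; have [T1 [_ nz1 e1 max]] := comb_lead Hlam nz.
have lt1 : prec (word T1) W by rewrite -e1; apply: lt; apply: lead_word_neq0.
by have [->//|] := max T nz; move/prec_trans; apply.
Qed.

Lemma form_comb_below u W a : (forall T, prec (word T) W -> form u (SP T) = 0) ->
  below W a -> form u (comb a) = 0.
Proof.
move=> orth bel; rewrite /comb form_sumr big1 // => T _; rewrite formZr.
have [->|nz] := eqVneq (a T) 0; first by rewrite rmorph0 mul0r.
by rewrite orth ?mulr0 //; apply: bel.
Qed.

(** The vector attached to T in Young's orthogonal basis, up to a scalar: its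
third property is what the Gram-Schmidt process provides, and its last one is
the eigenvector property. *)
Definition young_vector T (a : ST -> C) :=
  [/\ a T != 0,
      forall T', a T' != 0 -> T' = T \/ prec (word T') (word T),
      forall T', prec (word T') (word T) -> form (comb a) (SP T') = 0
    & forall k, jucys_murphy k (comb a) = word_content C (word T) k *: comb a].

(** One step of the Gram-Schmidt process as a linear system: there are fewer
conditions than unknowns, so a nonzero solution exists. *)
Lemma orth_vector_exists T : exists a : ST -> C,
  [/\ exists T', a T' != 0,
      forall T', a T' != 0 -> T' = T \/ prec (word T') (word T)
    & forall T', prec (word T') (word T) -> form (comb a) (SP T') = 0].
Proof.
pose T_ (i : 'I_#|{: ST}|) : ST := enum_val i.
(* The column of T is zero; the others state orthogonality to the Specht
   polynomials below T and the vanishing of the coordinates above T. *)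
pose M : 'M[C]_#|{: ST}| := \matrix_(i, j)
  if prec (word (T_ j)) (word T) then form (SP (T_ i)) (SP (T_ j))
  else if T_ j == T then 0 else (i == j)%:R.
have /det0P[v nzv vM] : \det M == 0.
  rewrite (expand_det_col M (enum_rank T)) big1 // => i _.
  by rewrite mxE /T_ enum_rankK prec_irr eqxx mul0r.
have vMj j : \sum_i v 0 i * M i j = 0.
  by have /rowP/(_ j) := vM; rewrite !mxE.
exists (fun T' => v 0 (enum_rank T')); split=> [|T' nz|T' lt].
- have [i nzi] : exists i, v 0 i != 0.
    apply/existsP; rewrite -negb_forall; apply: contra nzv => /forallP z.
    by apply/eqP/rowP => i; rewrite mxE; apply/eqP.
  by exists (T_ i); rewrite enum_valK.
- have [//|nlt] := boolP (prec (word T') (word T)); [by right|left].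
  apply/eqP; apply: contraT => ne; have := vMj (enum_rank T').
  rewrite (bigD1 (enum_rank T')) //= big1 ?addr0 => [|i /negPf ni].
    by rewrite mxE /T_ enum_rankK (negPf nlt) (negPf ne) eqxx mulr1 => /eqP;
       rewrite (negPf nz).
  by rewrite mxE /T_ enum_rankK (negPf nlt) (negPf ne) ni mulr0.
rewrite -(of_coords_comb v) /of_coords form_suml -[RHS](vMj (enum_rank T')).
apply: eq_bigr => i _; rewrite formZl; congr (_ * _).
by rewrite mxE /T_ enum_rankK lt.
Qed.

(** Let u be orthogonal to the span V of the Specht polynomials below T, with
leading word that of T.  Then r = X_k u - c u lies in V by triangularity, and
so does X_k r.  As X_k is self-adjoint, the square norm of r is the product of
u with X_k r minus c times its product with r, hence zero. *)
Lemma young_vector_exists T : exists a, young_vector T a.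
Proof.
have [a [[T0 nz0] supp orth]] := orth_vector_exists T.
exists a; set u := comb a.
have hu : highest u by apply: highest_comb.
have [T1 [nz1 u0 lead_u max]] := comb_lead Hlam nz0.
have nzT : a T != 0.
  apply: contraNneq u0 => z; apply/eqP; apply: form_eq0 => //.
  apply: (form_comb_below orth) => T' nz'; have [e|//] := supp _ nz'.
  by rewrite e z eqxx in nz'.
have eT : T1 = T.
  have [//|lt1] := supp _ nz1; have [//|lt2] := max _ nzT.
  by case: (prec_asym lt1 lt2).
rewrite eT in lead_u; split=> // k; set c := word_content _ _ _.
pose r := jucys_murphy k u - c *: u.
have hr : highest r by apply: highestB; [apply: highest_jm | apply: highestZ].
have below_r w : r@_w != 0 -> prec w (word T).
  by rewrite -lead_u => nzw; apply: (jm_triangular (card_cell t0) hu u0 (k := k));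
     rewrite lead_u.
have orth_u q : highest q -> (forall w, q@_w != 0 -> prec w (word T)) ->
    form u q = 0.
  move=> /(highest_specht_span Hlam t0)[b ->] lt.
  by apply: (form_comb_below orth); apply: comb_below.
have below_jr w : (jucys_murphy k r)@_w != 0 -> prec w (word T).
  have [->|r0] := eqVneq r 0.
    by rewrite /jucys_murphy big1 ?mcoeff0 ?eqxx // => i _; rewrite msym0.
  have lt_r : prec (lead_word r) (word T) by apply: below_r; apply: lead_word_neq0.
  pose cr := word_content C (lead_word r) k.
  have [z|nz _] := eqVneq (jucys_murphy k r - cr *: r)@_w 0.
    have -> : jucys_murphy k r = (jucys_murphy k r - cr *: r) + cr *: r.
      by rewrite subrK.
    rewrite mcoeffD z add0r mcoeffZ mulf_eq0 negb_or => /andP[_].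
    exact: below_r.
  apply: prec_trans lt_r.
  exact: (jm_triangular (card_cell t0) hr r0 nz).
have : r = 0.
  apply: form_eq0 => //; rewrite {1}/r -scaleNr formDl formZl form_jm.
  by rewrite !orth_u ?mulr0 ?addr0 //; apply: highest_jm.
by move/eqP; rewrite subr_eq0 => /eqP.
Qed.

Lemma young_orth T T' a a' : young_vector T a -> young_vector T' a' -> T <> T' ->
  form (comb a) (comb a') = 0.
Proof.
have half T1 T2 a1 a2 : young_vector T1 a1 -> young_vector T2 a2 ->
    prec (word T2) (word T1) -> form (comb a1) (comb a2) = 0.
  move=> [_ _ orth _] [_ supp _ _] lt; apply: (form_comb_below orth) => T3.
  by move=> /supp[->//|/prec_trans]; apply.
move=> y y' ne.
have : word T # rev_perm n != word T' # rev_perm n.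
  by rewrite (inj_eq (can_inj (@mperm_revK n))) (inj_eq (@word_inj lam n)); apply/eqP.
rewrite neq_lt => /orP[lt|lt]; last exact: half lt.
by rewrite formC (half _ _ _ _ y' y lt) rmorph0.
Qed.

Lemma young_norm T a : young_vector T a -> form (comb a) (comb a) != 0.
Proof.
move=> [nz _ _ _]; apply/eqP => /(form_eq0 (highest_comb Hlam a)).
by move/(specht_free Hlam)/(_ T)/eqP; rewrite (negPf nz).
Qed.

End InvariantForm.

(** * Contents separate standard tableaux *)
Section Contents.
Variables (lam : seq nat) (n : nat).
Hypothesis Hlam : is_partition lam n.
Implicit Types (T : std_tableau lam n) (c : cell lam).

Lemma standard_diag T c c' :
  (crow c < crow c')%N -> (ccol c < ccol c')%N -> (T c < T c')%N.
Proof.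
move=> rr cc; have /standardP[rs cs] : is_standard T by case: T.
have h : (ccol c' < nth 0%N lam (crow c))%N.
  by rewrite -(heightP Hlam) (ltn_trans rr) // (heightP Hlam) col_lt.
apply: (@ltn_trans (T (mkcell h))); first by apply: rs.
exact: cs.
Qed.

(** Take the smallest k that lies in different cells c of T and c' of T'.  Both
are on the same diagonal, say c before c'.  Then T' has at c an entry smaller
than k, which T has at c as well by minimality, although T has k there. *)
Lemma content_vector_inj T T' :
  (forall k, (ccol (cell_at T k) + crow (cell_at T' k) =
              ccol (cell_at T' k) + crow (cell_at T k))%N) -> T = T'.
Proof.
move=> eq_content.
suff same k : cell_at T k = cell_at T' k.
  apply/val_inj/tab_eq => c; rewrite -[T c](cell_atK T') -same tabK //.
have [m] := ubnP (k : nat); elim: m k => // m IH k; rewrite ltnS => km.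
have half (T1 T2 : std_tableau lam n) :
    (forall l : 'I_n, (l < k)%N -> cell_at T1 l = cell_at T2 l) ->
    (ccol (cell_at T1 k) + crow (cell_at T2 k) =
     ccol (cell_at T2 k) + crow (cell_at T1 k))%N ->
    ~~ (crow (cell_at T1 k) < crow (cell_at T2 k))%N.
  move=> IH12 e; apply/negP => rr.
  have lt := @standard_diag T2 (cell_at T1 k) (cell_at T2 k) rr.
  rewrite cell_atK in lt; have {}lt : (T2 (cell_at T1 k) < k)%N by apply: lt; lia.
  have := IH12 _ lt; rewrite tabK => /(congr1 T1).
  by rewrite !cell_atK => e'; rewrite e' ltnn in lt.
have IHk (l : 'I_n) : (l < k)%N -> cell_at T l = cell_at T' l.
  by move=> lk; apply: IH; apply: leq_trans lk km.
have h1 := half T T' IHk (eq_content k).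
have h2 := half T' T (fun l lk => esym (IHk l lk)) (esym (eq_content k)).
by apply: cell_ext; have := eq_content k; lia.
Qed.

End Contents.

(** * The Specht module as a representation *)
Section SpechtRepresentation.
Variables (lam : seq nat) (n : nat) (C : numClosedFieldType).
Hypotheses (Hlam : is_partition lam n) (t0 : tableau lam n).
Local Notation ST := (std_tableau lam n).
Local Notation SP T := (specht_poly C (std_tab T)).
Local Notation highest := (@highest lam n C).
Local Notation comb := (@comb lam n C).
Local Notation of_coords := (@of_coords lam n C).
Local Notation coords := (@coords lam n C).
Local Notation d := #|{: ST}|.
Local Notation form := (form t0).
Implicit Types (p q r : {mpoly C[n]}) (T : ST) (v : 'rV[C]_d).

HB.instance Definition _ :=
  GRing.isLinear.Build C 'rV[C]_d {mpoly C[n]} *:%R of_coords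
    (@of_coords_linear lam n C).

Definition specht_mx (s : 'S_n) : 'M[C]_d :=
  \matrix_i coords (msym s (SP (enum_val i))).

Lemma of_coords_mx s v : of_coords (v *m specht_mx s) = msym s (of_coords v).
Proof.
rewrite mulmx_sum_row linear_sum [in RHS]of_coordsE [RHS]linear_sum.
apply: eq_bigr => i _; rewrite !linearZ /= rowK (coordsK Hlam t0) //.
by apply: highest_msym; apply: highest_specht.
Qed.

Lemma specht_mx_repr : mx_repr [set: 'S_n]%G specht_mx.
Proof.
have inj := @of_coords_inj _ _ C Hlam.
have ext (A B : 'M[C]_d) : (forall v, v *m A = v *m B) -> A = B.
  by move=> e; apply/row_matrixP => i; rewrite !rowE.
split=> [|s s' _ _]; apply: ext => v; apply: inj.
  by rewrite of_coords_mx msym1m mulmx1.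
by rewrite of_coords_mx mulmxA of_coords_mx of_coords_mx msymMm.
Qed.

Definition specht_repr := MxRepresentation specht_mx_repr.

Lemma of_coords_jm k v :
  of_coords (v *m JM specht_repr k) = jucys_murphy k (of_coords v).
Proof.
rewrite /JM mulmx_sumr linear_sum; apply: eq_bigr => i _.
exact: of_coords_mx.
Qed.

Lemma specht_affords : affords (in_specht t0) specht_repr.
Proof.
exists of_coords; split=> [|p|s v]; first exact: of_coords_inj.
  split=> [/(in_spechtP Hlam) hp|[v ->]].
    by exists (coords p); apply: esym (coordsK Hlam t0 hp).
  by apply/(in_spechtP Hlam); apply: highest_of_coords.
exact: of_coords_mx.
Qed.

Section Eigenbasis.
Variable a_ : ST -> (ST -> C).
Hypothesis young_a : forall T, young_vector t0 T (a_ T).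

Let u_ T := comb (a_ T).
Let v_ T := coords (u_ T).

Let of_v T : of_coords (v_ T) = u_ T.
Proof. by apply: (coordsK Hlam t0); apply: highest_comb. Qed.

Lemma form_young_sum (b : ST -> C) T :
  form (of_coords (\sum_T' b T' *: v_ T')) (u_ T) = b T * form (u_ T) (u_ T).
Proof.
rewrite linear_sum form_suml (bigD1 T) //= linearZ /= formZl of_v.
rewrite big1 ?addr0 // => T' /eqP ne; rewrite linearZ /= formZl of_v.
by rewrite (young_orth (young_a T') (young_a T) ne) mulr0.
Qed.

Lemma young_free (b : ST -> C) : \sum_T b T *: v_ T = 0 -> forall T, b T = 0.
Proof.
move=> z T; have := form_young_sum b T; rewrite z linear0 form0l => /esym/eqP.
by rewrite mulf_eq0 (negPf (young_norm Hlam (young_a T))) orbF => /eqP.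
Qed.

Lemma young_span v : exists b : ST -> C, v = \sum_T b T *: v_ T.
Proof.
pose B : 'M[C]_d := \matrix_i v_ (enum_val i).
have mulB w : w *m B = \sum_T w 0 (enum_rank T) *: v_ T.
  rewrite mulmx_sum_row (reindex (@enum_rank ST)) /=; last first.
    by apply: onW_bij; apply: enum_rank_bij.
  by apply: eq_bigr => T _; rewrite rowK enum_rankK.
have uB : B \in unitmx.
  rewrite unitmxE unitfE; apply/negP => /det0P[w nz]; rewrite mulB => /young_free z.
  by case/eqP: nz; apply/rowP => i; rewrite mxE -(z (enum_val i)) enum_valK.
by exists (fun T => (v *m invmx B) 0 (enum_rank T)); rewrite -mulB mulmxKV.
Qed.

Lemma young_jm T k :
  v_ T *m JM specht_repr k = word_content C (word T) k *: v_ T.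
Proof.
apply: (@of_coords_inj _ _ C Hlam); rewrite of_coords_jm linearZ /= of_v.
by case: (young_a T).
Qed.

Lemma young_eigenvector T c :
  v_ T *m JM specht_repr (T c) = (content c)%:~R *: v_ T.
Proof.
by rewrite young_jm /word_content occ_word wordE /content rmorphB.
Qed.

Lemma separating_jm T T' : T != T' ->
  exists k, word_content C (word T) k != word_content C (word T') k.
Proof.
move=> ne; apply/existsP; apply: contraNT ne; rewrite negb_exists => /forallP e.
apply/eqP/(content_vector_inj Hlam) => k; apply/eqP.
have occ_cell (T1 : ST) : occ (word T1) k = ccol (cell_at T1 k).
  by rewrite -{1}(cell_atK T1 k) occ_word.
have word_cell (T1 : ST) : word T1 k = crow (cell_at T1 k).
  by rewrite -{1}(cell_atK T1 k) wordE.
have := e k; rewrite negbK /word_content !occ_cell !word_cell.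
by rewrite subr_eq addrAC eq_sym subr_eq -!natrD eqr_nat eq_sym.
Qed.

Variable T0 : ST.
Hypothesis T0_min : forall T, T = T0 \/ prec (word T0) (word T).

Lemma u_min : u_ T0 = a_ T0 T0 *: SP T0.
Proof.
rewrite /u_ /comb (bigD1 T0) //= big1 ?addr0 // => T ne.
have [->|nz] := eqVneq (a_ T0 T) 0; first by rewrite scale0r.
have [_ /(_ T nz) [e|lt] _ _] := young_a T0; first by rewrite e eqxx in ne.
have [e|/(prec_asym lt)//] := T0_min T; by rewrite e eqxx in ne.
Qed.

Lemma min_generates p : highest p ->
  exists b : 'S_n -> C, p = \sum_s b s *: msym s (u_ T0).
Proof.
have nz : a_ T0 T0 != 0 by case: (young_a T0).
move=> /(in_spechtP Hlam T0)[b ->]; exists (fun s => b s / a_ T0 T0).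
by apply: eq_bigr => s _; rewrite u_min msymZ scalerA divfK.
Qed.

(** A submodule orthogonal to a generator of the whole module is orthogonal to
everything, itself included, because the form is invariant. *)
Lemma submodule_meets_min m (U : 'M[C]_(m, d)) :
  (forall s, U *m specht_mx s <= U)%MS -> U != 0 ->
  exists2 v, (v <= U)%MS & form (of_coords v) (u_ T0) != 0.
Proof.
move=> modU nzU; pose v := nz_row U.
have vU : (v <= U)%MS by apply: nz_row_sub.
have hv : highest (of_coords v) by apply: highest_of_coords.
have nzv : form (of_coords v) (of_coords v) != 0.
  apply: contraNneq nzU => /(form_eq0 hv); rewrite -nz_row_eq0 -/v => z.
  by apply/eqP; apply: (@of_coords_inj _ _ C Hlam); rewrite z linear0.
have [b bE] := min_generates hv.
have [s nzs] : exists s, form (of_coords v) (msym s (u_ T0)) != 0.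
  apply/existsP; rewrite -negb_forall; apply: contra nzv => /forallP z.
  rewrite {2}bE form_sumr big1 // => s _.
  by rewrite formZr (eqP (z s)) mulr0.
exists (v *m specht_mx s^-1); last by rewrite of_coords_mx form_msym_adj invgK.
by apply: submx_trans (modU s^-1%g); apply: submxMr.
Qed.

(** Start from a vector not orthogonal to the vector of [T0].  For each other T,
some X_k has different eigenvalues on the two basis vectors, and X_k minus its
eigenvalue at T removes the component along T and keeps the one along [T0]. *)
Lemma submodule_contains_min m (U : 'M[C]_(m, d)) :
  (forall s, U *m specht_mx s <= U)%MS -> U != 0 -> (v_ T0 <= U)%MS.
Proof.
move=> modU nzU.
have modJ v k : (v <= U)%MS -> (v *m JM specht_repr k <= U)%MS.
  move=> vU; rewrite /JM mulmx_sumr; apply: summx_sub => i _.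
  by apply: submx_trans (modU (tperm i k)); apply: submxMr.
have filter (l : seq ST) : T0 \notin l -> exists v, [/\ (v <= U)%MS,
    form (of_coords v) (u_ T0) != 0 &
    forall T, T \in l -> form (of_coords v) (u_ T) = 0].
  elim: l => [|T l IH].
    by have [v vU nz] := submodule_meets_min modU nzU; exists v.
  rewrite inE negb_or => /andP[/separating_jm[k sep] /IH[v [vU nz zl]]].
  pose c := word_content C (word T) k.
  have formE T' : form (of_coords (v *m JM specht_repr k - c *: v)) (u_ T') =
      (word_content C (word T') k - c) * form (of_coords v) (u_ T').
    rewrite linearB linearZ /= of_coords_jm -scaleNr formDl formZl form_jm.
    have [_ _ _ ->] := young_a T'; rewrite formZr mulrBl mulNr.
    by rewrite /word_content rmorphB /= !conjC_nat.
  exists (v *m JM specht_repr k - c *: v); split.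
  - by rewrite addmx_sub ?eqmx_opp ?scalemx_sub ?modJ.
  - by rewrite formE mulf_neq0 // subr_eq0.
  - move=> T'; rewrite inE formE => /orP[/eqP ->|/zl ->]; last by rewrite mulr0.
    by rewrite subrr mul0r.
have [|v [vU nz z]] := filter [seq T <- enum {: ST} | T != T0].
  by rewrite mem_filter eqxx.
have [b bE] := young_span v.
have b0 T : T != T0 -> b T = 0.
  move=> ne; have := z T; rewrite mem_filter ne mem_enum => /(_ isT)/eqP.
  rewrite bE form_young_sum mulf_eq0 => /orP[/eqP //|].
  by rewrite (negPf (young_norm Hlam (young_a T))).
have vE : v = b T0 *: v_ T0.
  by rewrite bE (bigD1 T0) //= big1 ?addr0 // => T /b0 ->; rewrite scale0r.
have nzb : b T0 != 0.
  by apply: contraNneq nz => e; rewrite vE e scale0r linear0 form0l.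
by rewrite -(scale1r (v_ T0)) -(mulVf nzb) -scalerA -vE scalemx_sub.
Qed.

(** Each nonzero submodule contains the vector of [T0], which generates. *)
Lemma specht_irreducible : mx_irreducible specht_repr.
Proof.
apply/mx_irrP; split; first by apply/card_gt0P; exists T0.
move=> U /mxmoduleP modU nzU.
have modU' s : (U *m specht_mx s <= U)%MS by apply: modU; rewrite inE.
have T0U := submodule_contains_min modU' nzU.
rewrite -sub1mx; apply/row_subP => i.
have [b bE] := min_generates (highest_of_coords Hlam (row i 1%:M)).
have -> : row i 1%:M = \sum_s b s *: (v_ T0 *m specht_mx s).
  apply: (@of_coords_inj _ _ C Hlam); rewrite bE linear_sum.
  by apply: eq_bigr => s _; rewrite linearZ /= of_coords_mx of_v.
apply: summx_sub => s _; apply: scalemx_sub.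
by apply: submx_trans (modU' s); apply: submxMr.
Qed.

End Eigenbasis.

Lemma std_tableau_exists : exists T : ST, True.
Proof.
have [T _] := highest_lead_word t0 (highest_specht C t0 Hlam) (specht_neq0 C t0).
by exists T.
Qed.

Lemma min_tableau_exists :
  exists T0 : ST, forall T, T = T0 \/ prec (word T0) (word T).
Proof.
have [T1 _] := std_tableau_exists.
case: (@Order.TotalTheory.arg_minP _ _ _ T1 predT
         (fun T => word T # rev_perm n) isT) => T0 _ minT.
exists T0 => T; have := minT T isT; rewrite /= le_eqVlt.
case/orP=> [/eqP e|]; [left | by right].
by apply/esym/word_inj/(can_inj (@mperm_revK n)).
Qed.

Lemma specht_is_pi : is_pi lam specht_repr.
Proof.
have [a_ young_a] := fin_all_exists (young_vector_exists C Hlam t0).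
have [T0 T0_min] := min_tableau_exists.
split; first exact: specht_irreducible young_a _ T0_min.
exists (fun T => coords (comb (a_ T))); split; last exact: young_eigenvector.
split=> [b|v]; first exact: young_free.
by split=> // _; apply: young_span.
Qed.

Lemma specht_module_theorem :
  [/\ [/\ is_submodule (@in_L C lam n),
          is_submodule (@in_specht C lam n t0)
        & forall p : {mpoly C[n]},
            in_specht t0 p <-> in_L lam p /\ translation_invariant p],
      exists (d : nat) (rho : mx_representation C [set: 'S_n]%G d),
        is_pi lam rho /\ affords (in_specht t0) rho
    & is_basis (in_specht t0) (fun T : ST => specht_poly C T)].
Proof.
have inL p := in_L_weighted (card_cell t0) p.
have inS p := in_spechtP Hlam t0 p.
split.
- split.
  + split; first by apply/inL; apply: weighted0.
      by move=> a p q /inL wp /inL wq; apply/inL; apply: weighted_lin.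
    by move=> s p /inL wp; apply/inL; apply: weighted_msym.
  + split; first by apply/inS; apply: highest0.
      by move=> a p q /inS hp /inS hq; apply/inS; apply: highest_lin.
    by move=> s p /inS hp; apply/inS; apply: highest_msym.
  + move=> p; split=> [/inS hp|[/inL wp ti]].
      by split; [apply/inL; case: hp | apply: (highest_invariant Hlam t0)].
    by apply/inS; apply: highest_of_invariant.
- exists d, specht_repr; split; [exact: specht_is_pi | exact: specht_affords].
split=> [a z|p]; first exact: (specht_free Hlam z).
by split=> [/inS/(highest_specht_span Hlam t0)|/(highest_specht_span Hlam t0)/inS].
Qed.

End SpechtRepresentation.

Theorem theorem5 (R : realType) (n : nat) (lam : seq nat)
    (Hlam : is_partition lam n) (t0 : tableau lam n) :
  [/\ (* 1 *)
      [/\ is_submodule (@in_L R[i] lam n),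
          is_submodule (@in_specht R[i] lam n t0)
        & forall p : {mpoly R[i][n]},
            @in_specht R[i] lam n t0 p
            <-> @in_L R[i] lam n p /\ @translation_invariant R[i] n p],
      (* 2 *)
      exists (d : nat) (rho : mx_representation R[i] [set: 'S_n]%G d),
        @is_pi R[i] lam n d rho /\ affords (@in_specht R[i] lam n t0) rho
    & (* 3 *)
      is_basis (@in_specht R[i] lam n t0)
               (fun T : std_tableau lam n => specht_poly R[i] T)].
Proof. exact: (@specht_module_theorem lam n R[i] Hlam t0). Qed.
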